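(* Let $G_1$ be a finite connected oriented graph with distinguished vertices $a_1,b_1$ such that $d_1(a_1,b_1)>1$ and there exist at least two edge-disjoint paths connecting $a_1$ to $b_1$ in $G_1$, and let $(G_k)$ be the hierarchical graphs with seed $G_1$. For each $k$ let $E_k$ be an edge chosen uniformly at random in $\mathcal E_k$. Then the random edge-rooted graphs $\bar G_k=(G_k,E_k)$ converge in distribution in $\mathcal G$ (that is, $(G_k)$ converges in the Benjamini–Schramm sense) to a random edge-rooted graph $\bar G_\infty=(G_\infty,E_\infty)\in\mathcal G$, with law denoted $\mu_\infty$. Likewise, the random edge-rooted marked graphs $(G_k,E_k,\mathsf m_k)$ converge in distribution in $\mathcal G_{\mathcal A}$ to a random edge-rooted marked graph $(G_\infty,E_\infty,\mathsf m_\infty)\in\mathcal G_{\mathcal A}$.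
   Context: $G_1=(V_1,\mathcal E_1)$ is a finite connected oriented graph (a finite simple graph with an orientation chosen for each edge), with two distinguished vertices $a_1,b_1$. Distances and paths ignore orientation; $d_1$ is the graph distance in $G_1$. Hierarchical graphs: $G_0$ is a single oriented edge $(a_0,b_0)$. Given $G_k=(V_k,\mathcal E_k)$ with distinguished vertices $a_k,b_k$, $G_{k+1}$ is obtained by replacing each oriented edge $(x,y)\in\mathcal E_k$ by a fresh copy of $G_1$, with $a_1$ identified with $x$ and $b_1$ with $y$; $a_{k+1},b_{k+1}$ are the vertices that were $a_k,b_k$. Addresses: there is a bijection $A_k:\mathcal E_k\to\mathcal E_1^k$, defined by $A_0(\text{only edge})=\varnothing$ and, if $e\in\mathcal E_{k+1}$ is the edge $e''\in\mathcal E_1$ of the copy of $G_1$ replacing $e'\in\mathcal E_k$, $A_{k+1}(e)=A_k(e')e''$ (concatenation). Space $\mathcal G$: connected, locally finite graphs with a distinguished (root) edge, up to root-preserving isomorphism (orientations are forgotten). For $r\ge0$, $(G,e)|_r$ is the subgraph induced by the vertices within distance $r$ of an endpoint of $e$, rooted at $e$. The metric is $d(\bar G,\bar G')=\inf\{1/(r+1): \bar G|_r\cong\bar G'|_r\}$. Marks: $\mathcal A=\mathcal E_1^{\mathbb Z_-}\cup\bigcup_{k\ge1}\mathcal E_1^{(-k,\dots,-1)}$, with $\mathbb Z_-=\{\dots,-2,-1\}$. For $w\in\mathcal A$, $w|_r$ is the word formed by the last $r$ letters of $w$ (those closest to index $-1$) if $w$ has length at least $r$, and $w|_r=w$ otherwise.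 $\mathcal G_{\mathcal A}$ is the set of triples $(G,e,\mathsf m)$ with $(G,e)\in\mathcal G$ and $\mathsf m$ a map from the edge set of $G$ to $\mathcal A$ (up to isomorphism), with distance the infimum of $\frac1{r+1}+\frac1{j+1}$ over $(r,j)$ such that there is a root-preserving isomorphism between $(G,e)|_r$ and $(G',e')|_r$ preserving the restricted marks $\mathsf m|_j$, $\mathsf m'|_j$ (restriction taken edge by edge). $\mathsf m_k(e)$ is the address $A_k(e)$, its letters indexed by $-k,\dots,-1$ in order (so the last letter has index $-1$). *)

(* Defs.v *)
From HB Require Import structures.
From mathcomp Require Import all_boot all_order all_algebra.
From mathcomp Require Import generic_quotient.
From mathcomp Require Import all_classical all_reals all_analysis.
Set Implicit Arguments.
Unset Strict Implicit.
Unset Printing Implicit Defensive.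
Import Order.TTheory GRing.Theory Num.Theory.
Import numFieldNormedType.Exports.
Local Open Scope classical_set_scope.
Local Open Scope ring_scope.
Local Open Scope quotient_scope.

Definition walk (T : eqType) (e : rel T) (x y : T) (n : nat) : Prop :=
  exists p, [/\ path e x p, last x p = y & size p = n].

(* Only meaningful when [x] and [y] are connected; the junk value is [0]. *)
Definition gdist (T : eqType) (e : rel T) (x y : T) : nat :=
  match pselect (exists n, `[< walk e x y n >]) with
  | left ex_walk => ex_minn ex_walk
  | right _ => 0
  end.

Lemma gdist_le (T : eqType) (e : rel T) x y n : walk e x y n -> (gdist e x y <= n)%N.
Proof.
move=> w; rewrite /gdist; case: pselect => // h.
by case: ex_minnP => m _; apply; apply/asboolP.
Qed.

Lemma gdistP (T : eqType) (e : rel T) x y :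
  (exists n, walk e x y n) -> walk e x y (gdist e x y).
Proof.
move=> [n w]; rewrite /gdist; case: pselect => [h|[]].
  by case: ex_minnP => m /asboolP.
by exists n; apply/asboolP.
Qed.

(* A connected, locally finite graph is countable, so its vertices may be taken
   in [nat]; the choice is immaterial after the quotient by isomorphism. *)
Record rgraph := RGraph {
  vtx : set nat;
  adj : rel nat;
  root : nat * nat;
  adj_vtx : forall x y, adj x y -> vtx x;
  adj_sym : symmetric adj;
  adj_irr : irreflexive adj;
  rgraph_conn : forall x y, vtx x -> vtx y -> exists n, walk adj x y n;
  rgraph_locfin : forall x, finite_set [set y | adj x y];
  root_adj : adj root.1 root.2
}.

(* The vertex set of [(G, e)|_r]. *)
Definition near_root (G : rgraph) (r : nat) : set nat :=
  [set x | vtx G x /\ ((gdist (adj G) (root G).1 x <= r)%N \/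
                       (gdist (adj G) (root G).2 x <= r)%N)].

(* [f] is a root-preserving isomorphism from the subgraph of [G] induced by [A]
   to the subgraph of [G'] induced by [A']. The root is an unoriented edge, so
   [f] may exchange its endpoints. *)
Definition induced_iso (G G' : rgraph) (A A' : set nat) (f : nat -> nat) : Prop :=
  [/\ set_bij A A' f,
      forall x y, A x -> A y -> adj G' (f x) (f y) = adj G x y &
      (f (root G).1, f (root G).2) = root G' \/
      (f (root G).2, f (root G).1) = root G'].

Definition rgraph_iso (G G' : rgraph) : Prop :=
  exists f, induced_iso G G' (vtx G) (vtx G') f.

Definition ball_iso (r : nat) (G G' : rgraph) : Prop :=
  exists f, induced_iso G G' (near_root G r) (near_root G' r) f.

Section rgraph_lemmas.
Implicit Types (G H K : rgraph) (A B C : set nat).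

Lemma root_vtx1 G : vtx G (root G).1.
Proof. exact: adj_vtx (root_adj G). Qed.

Lemma root_vtx2 G : vtx G (root G).2.
Proof. by apply: (@adj_vtx _ _ (root G).1); rewrite adj_sym root_adj. Qed.

Lemma walk_vtx G x y n : vtx G x -> walk (adj G) x y n -> vtx G y.
Proof.
move=> vx [p [pp <- _]]; elim: p x vx pp => //= z p IH x _ /andP[xz pz].
by apply: IH pz; apply: (@adj_vtx _ _ x); rewrite adj_sym.
Qed.

Lemma near_rootP G r x : near_root G r x <->
  exists2 n, (n <= r)%N & walk (adj G) (root G).1 x n \/ walk (adj G) (root G).2 x n.
Proof.
split=> [[vx]|[n nr w]].
  case=> d; (eexists; first exact: d).
  - by left; apply/gdistP/rgraph_conn => //; exact: root_vtx1.
  - by right; apply/gdistP/rgraph_conn => //; exact: root_vtx2.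
split.
  by case: w; apply: walk_vtx; [exact: root_vtx1|exact: root_vtx2].
by case: w => /gdist_le d; [left|right]; exact: leq_trans d nr.
Qed.

Lemma near_sub_vtx G r : near_root G r `<=` vtx G.
Proof. by move=> x []. Qed.

Lemma near_mono G r s : (r <= s)%N -> near_root G r `<=` near_root G s.
Proof. by move=> rs x [vx d]; split=> //; case: d => d; [left|right]; exact: leq_trans rs. Qed.

Lemma walk0 (e : rel nat) x : walk e x x 0.
Proof. by exists [::]. Qed.

Lemma near_root1 G r : near_root G r (root G).1.
Proof. by apply/near_rootP; exists 0%N => //; left; exact: walk0. Qed.

Lemma near_root2 G r : near_root G r (root G).2.
Proof. by apply/near_rootP; exists 0%N => //; right; exact: walk0. Qed.

Definition inverse_on A B (f g : nat -> nat) :=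
  (forall x, A x -> B (f x) /\ g (f x) = x) /\ (forall y, B y -> A (g y) /\ f (g y) = y).

Lemma induced_iso_inv G H A B f : A (root G).1 -> A (root G).2 ->
  induced_iso G H A B f -> exists2 g, inverse_on A B f g & induced_iso H G B A g.
Proof.
move=> A1 A2 [[fB finj fsurj] fadj froot].
have ex y : exists x, B y -> A x /\ f x = y.
  case: (pselect (B y)) => [/fsurj[x Ax fx]|nB]; last by exists 0%N.
  by exists x.
have [g gP] := boolp.choice ex.
have fg : inverse_on A B f g.
  split=> [x Ax|y /gP //].
  have Bx : B (f x) by exact: fB.
  have [Ag e] := gP _ Bx; split=> //.
  by apply: finj; rewrite ?in_setE.
exists g => //; split.
- split=> [y /gP[]|y z|x Ax] //.
  + by rewrite !in_setE => /gP[_ ey] /gP[_ ez] e; rewrite -ey -ez e.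
  + by have [Bx gx] := fg.1 _ Ax; exists (f x).
- move=> x y Bx By; have [Ax ex'] := gP _ Bx; have [Ay ey] := gP _ By.
  by rewrite -fadj // ex' ey.
- by case: froot => <- /=; rewrite !(fg.1 _ _).2 //; [left|right]; case: (root G).
Qed.

Lemma induced_iso_comp G H K A B C f g :
  induced_iso G H A B f -> induced_iso H K B C g -> induced_iso G K A C (g \o f).
Proof.
move=> [fbij fadj froot] [gbij gadj groot].
have fB x : A x -> B (f x) by case: fbij => + _ _; apply.
split.
- exact: set_bij_comp fbij gbij.
- by move=> x y Ax Ay /=; rewrite gadj ?fadj //; exact: fB.
- by move: groot; case: froot => <- /= [] <-; [left|right|right|left].
Qed.

Lemma induced_iso_id G A : induced_iso G G A A id.
Proof.
by split=> //; [split=> [//|x y _ _ //|x Ax]; exists x|left; case: (root G)].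
Qed.

Lemma induced_iso_walk G H A B f r x y n :
  A `<=` vtx G -> near_root G r `<=` A ->
  x = (root G).1 \/ x = (root G).2 ->
  induced_iso G H A B f -> (n <= r)%N ->
  walk (adj G) x y n -> walk (adj H) (f x) (f y) n.
Proof.
move=> AV nA xroot [_ fadj _]; elim: n y => [|n IH] y nr [p [pp lp sp]].
  by rewrite (size0nil sp) in lp; rewrite -lp; exact: walk0.
case/lastP: p pp lp sp => // p z; rewrite rcons_path last_rcons size_rcons.
move=> /andP[pp az] ? [sp]; subst z.
have wl : walk (adj G) x (last x p) n by exists p.
have wy : walk (adj G) x y n.+1.
  by exists (rcons p y); rewrite rcons_path last_rcons size_rcons pp az sp.
have nearw u m : (m <= r)%N -> walk (adj G) x u m -> A u.
  by move=> mr w; apply/nA/near_rootP; exists m => //; case: xroot => <-; [left|right].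
have [q [pq lq sq]] := IH _ (ltnW nr) wl.
exists (rcons q (f y)); rewrite rcons_path last_rcons size_rcons pq lq sq; split=> //.
rewrite fadj ?az //; [exact: nearw (ltnW nr) wl|exact: nearw nr wy].
Qed.

Lemma induced_iso_near G H A B f r :
  A `<=` vtx G -> near_root G r `<=` A -> induced_iso G H A B f ->
  forall x, near_root G r x -> near_root H r (f x).
Proof.
move=> AV nA fiso x /near_rootP[n nr w]; apply/near_rootP; exists n => //.
have h u : u = (root G).1 \/ u = (root G).2 -> walk (adj G) u x n ->
  walk (adj H) (f u) (f x) n by move=> ur; exact: induced_iso_walk fiso nr.
case: (fiso) => _ _ [] <- /=; case: w => w; [left|right|right|left];
  apply: (h _ _ w); by [left|right].
Qed.

Lemma induced_iso_restrict G H A B f r :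
  A `<=` vtx G -> B `<=` vtx H -> near_root G r `<=` A -> near_root H r `<=` B ->
  induced_iso G H A B f -> induced_iso G H (near_root G r) (near_root H r) f.
Proof.
move=> AV BV nA nB fiso.
have [g [gl gr] giso] : exists2 g, inverse_on A B f g & induced_iso H G B A g.
  by apply: induced_iso_inv fiso; apply: nA; [exact: near_root1|exact: near_root2].
have [[_ finj _] fadj froot] := fiso; split=> //.
- split.
  + by move=> x nx; exact: induced_iso_near fiso _ nx.
  + by move=> x y; rewrite !in_setE => nx ny; apply: finj; rewrite in_setE; exact: nA.
  + move=> y ny; exists (g y); first exact: induced_iso_near giso _ ny.
    by have [_] := gr _ (nB _ ny).
- by move=> x y nx ny; apply: fadj; exact: nA.
Qed.

Lemma ball_iso_mono G H r s : (s <= r)%N -> ball_iso r G H -> ball_iso s G H.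
Proof.
move=> sr [f fiso]; exists f; apply: induced_iso_restrict fiso;
  by [exact: near_sub_vtx|exact: near_mono].
Qed.

Lemma ball_iso_sym G H r : ball_iso r G H -> ball_iso r H G.
Proof.
move=> [f /(induced_iso_inv (@near_root1 _ _) (@near_root2 _ _))[g _ giso]].
by exists g.
Qed.

Lemma ball_iso_trans G H K r : ball_iso r G H -> ball_iso r H K -> ball_iso r G K.
Proof. by move=> [f fi] [g gi]; exists (g \o f); exact: induced_iso_comp gi. Qed.

Lemma ball_iso_refl G r : ball_iso r G G.
Proof. by exists id; exact: induced_iso_id. Qed.

Lemma near0 G x : near_root G 0 x -> x = (root G).1 \/ x = (root G).2.
Proof.
move=> /near_rootP[n]; rewrite leqn0 => /eqP->.
by move=> [] [p [_ <- /size0nil ->]]; [left|right].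
Qed.

Lemma root_neq G : ((root G).1 == (root G).2) = false.
Proof.
by apply/negP => /eqP e; have := root_adj G; rewrite e adj_irr.
Qed.

Lemma induced_iso0 G H : exists f, induced_iso G H (near_root G 0) (near_root H 0) f.
Proof.
exists (fun x => if x == (root G).1 then (root H).1 else (root H).2).
have r2 : ((root G).2 == (root G).1) = false by rewrite eq_sym root_neq.
have rH2 : ((root H).2 == (root H).1) = false by rewrite eq_sym root_neq.
split.
- split.
  + by move=> x _; case: ifP => _; [exact: near_root1|exact: near_root2].
  + move=> x y; rewrite !in_setE => /near0[] -> /near0[] ->; rewrite ?eqxx ?r2 //.
      by move/eqP; rewrite root_neq.
    by move/eqP; rewrite rH2.
  + move=> y /near0[] ->.
      by exists (root G).1; rewrite ?eqxx //; exact: near_root1.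
    by exists (root G).2; rewrite ?r2 //; exact: near_root2.
- move=> x y /near0[] -> /near0[] ->; rewrite ?eqxx ?r2 ?adj_irr ?root_adj //.
  by rewrite adj_sym root_adj adj_sym root_adj.
- by left; rewrite eqxx r2; case: (root H).
Qed.

Lemma rgraph_iso_refl G : rgraph_iso G G.
Proof. by exists id; exact: induced_iso_id. Qed.

Lemma rgraph_iso_sym G H : rgraph_iso G H -> rgraph_iso H G.
Proof.
by move=> [f /(induced_iso_inv (@root_vtx1 _) (@root_vtx2 _))[g _ giso]]; exists g.
Qed.

Lemma rgraph_iso_trans G H K : rgraph_iso G H -> rgraph_iso H K -> rgraph_iso G K.
Proof. by move=> [f fi] [g gi]; exists (g \o f); exact: induced_iso_comp gi. Qed.

Lemma rgraph_iso_ball G H r : rgraph_iso G H -> ball_iso r G H.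
Proof.
by move=> [f fiso]; exists f; apply: induced_iso_restrict fiso => //; exact: near_sub_vtx.
Qed.

End rgraph_lemmas.

(* In [InfWord w], the letter of index [-(i+1)] is [w i]. *)
Inductive mark (E : Type) : Type :=
  | FinWord (k : nat) (w : k.+1.-tuple E)
  | InfWord (w : nat -> E).

Definition mark_restr (E : Type) (r : nat) (m : mark E) : seq E :=
  match m with
  | FinWord k w => drop (k.+1 - r) w
  | InfWord w => [seq w i | i <- rev (iota 0 r)]
  end.

Lemma mark_restr0 (E : Type) (m : mark E) : mark_restr 0 m = [::].
Proof. by case: m => //= k w; rewrite subn0 drop_oversize // size_tuple. Qed.

Lemma mark_restr_restr (E : Type) (m : mark E) r s : (s <= r)%N ->
  mark_restr s m = drop (size (mark_restr r m) - s) (mark_restr r m).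
Proof.
move=> sr; case: m => [k w|w] /=.
  rewrite size_drop size_tuple drop_drop; congr drop.
  case: (leqP r k.+1) => h; first by rewrite subKn // addnC addnBA // subnK.
  by have /eqP-> : (k.+1 - r == 0)%N; [rewrite subn_eq0 ltnW|rewrite subn0 addn0].
rewrite size_map size_rev size_iota -map_drop; congr map.
by rewrite drop_rev size_iota subKn // take_iota (minn_idPl sr).
Qed.

(* A mark on the edge set is a symmetric function of the endpoints. Its values
   at pairs that are not edges are irrelevant: [induced_miso] ignores them. *)
Record mgraph (E : Type) := MGraph {
  mgraph_rgraph :> rgraph;
  edge_mark : nat -> nat -> mark E;
  edge_mark_sym : forall x y, edge_mark x y = edge_mark y x
}.

(* [f] preserves the marks after they have been read through [h]. *)
Definition induced_miso (E F : Type) (h : mark E -> F) (G G' : mgraph E)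
    (A A' : set nat) (f : nat -> nat) : Prop :=
  induced_iso G G' A A' f /\
  forall x y, A x -> A y -> adj G x y ->
    h (edge_mark G' (f x) (f y)) = h (edge_mark G x y).

Definition mgraph_iso (E : Type) (G G' : mgraph E) : Prop :=
  exists f, induced_miso id G G' (vtx G) (vtx G') f.

Definition ball_miso (E : Type) (r j : nat) (G G' : mgraph E) : Prop :=
  exists f, induced_miso (mark_restr j) G G' (near_root G r) (near_root G' r) f.

Section mgraph_lemmas.
Context {E : Type}.
Implicit Types (G H K : mgraph E) (A B C : set nat).

Lemma induced_miso_inv F (h : mark E -> F) G H A B f :
  A (root G).1 -> A (root G).2 ->
  induced_miso h G H A B f -> exists g, induced_miso h H G B A g.
Proof.
move=> A1 A2 [fiso fm]; have [g [gl gr] giso] := induced_iso_inv A1 A2 fiso.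
exists g; split=> // x y Bx By xy; have [Ax ex] := gr _ Bx; have [Ay ey] := gr _ By.
by rewrite -fm // ?ex ?ey //; case: giso => _ -> .
Qed.

Lemma induced_miso_comp F (h : mark E -> F) G H K A B C f g :
  induced_miso h G H A B f -> induced_miso h H K B C g ->
  induced_miso h G K A C (g \o f).
Proof.
move=> [fi fm] [gi gm]; split; first exact: induced_iso_comp gi.
have [[fAB _ _] fadj _] := fi.
have fB x : A x -> B (f x) by exact: fAB.
move=> x y Ax Ay xy /=; rewrite gm ?fm //; [exact: fB|exact: fB|].
by rewrite fadj.
Qed.

Lemma induced_miso_id F (h : mark E -> F) G A : induced_miso h G G A A id.
Proof. by split=> //; exact: induced_iso_id. Qed.

Lemma ball_miso_mono G H r s i j : (s <= r)%N -> (i <= j)%N ->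
  ball_miso r j G H -> ball_miso s i G H.
Proof.
move=> sr ij [f [fiso fm]]; exists f; split.
  by apply: induced_iso_restrict fiso; [exact: near_sub_vtx|exact: near_sub_vtx|exact: near_mono|exact: near_mono].
move=> x y nx ny xy.
rewrite (mark_restr_restr _ ij) [RHS](mark_restr_restr _ ij) fm //; exact: (near_mono sr).
Qed.

Lemma ball_miso_sym G H r j : ball_miso r j G H -> ball_miso r j H G.
Proof.
by move=> [f /(induced_miso_inv (@near_root1 _ _) (@near_root2 _ _))].
Qed.

Lemma ball_miso_trans G H K r j :
  ball_miso r j G H -> ball_miso r j H K -> ball_miso r j G K.
Proof. by move=> [f fi] [g gi]; exists (g \o f); exact: induced_miso_comp gi. Qed.

Lemma ball_miso_refl G r j : ball_miso r j G G.
Proof. by exists id; exact: induced_miso_id. Qed.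

Lemma ball_miso0 G H : ball_miso 0 0 G H.
Proof.
have [f fiso] := induced_iso0 G H; exists f; split=> // x y _ _ _.
by rewrite !mark_restr0.
Qed.

Lemma mgraph_iso_refl G : mgraph_iso G G.
Proof. by exists id; exact: induced_miso_id. Qed.

Lemma mgraph_iso_sym G H : mgraph_iso G H -> mgraph_iso H G.
Proof. by move=> [f /(induced_miso_inv (@root_vtx1 _) (@root_vtx2 _))]. Qed.

Lemma mgraph_iso_trans G H K : mgraph_iso G H -> mgraph_iso H K -> mgraph_iso G K.
Proof. by move=> [f fi] [g gi]; exists (g \o f); exact: induced_miso_comp gi. Qed.

Lemma mgraph_iso_ball G H r j : mgraph_iso G H -> ball_miso r j G H.
Proof.
move=> [f [fiso fm]]; exists f; split.
  by apply: induced_iso_restrict fiso => //; exact: near_sub_vtx.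
by move=> x y nx ny xy; have /= -> := fm x y (near_sub_vtx nx) (near_sub_vtx ny) xy.
Qed.

Lemma mgraph_iso_rgraph G H : mgraph_iso G H -> rgraph_iso G H.
Proof. by move=> [f [fiso _]]; exists f. Qed.

End mgraph_lemmas.

HB.instance Definition _ := gen_eqMixin rgraph.
HB.instance Definition _ := gen_choiceMixin rgraph.

Definition rgraph_isob (G G' : rgraph) : bool := `[< rgraph_iso G G' >].

Lemma rgraph_isob_refl : reflexive rgraph_isob.
Proof. by move=> G; apply/asboolP; exact: rgraph_iso_refl. Qed.

Lemma rgraph_isob_sym : symmetric rgraph_isob.
Proof. by move=> G H; apply/asboolP/asboolP; exact: rgraph_iso_sym. Qed.

Lemma rgraph_isob_trans : transitive rgraph_isob.
Proof.
by move=> H G K /asboolP GH /asboolP HK; apply/asboolP; exact: rgraph_iso_trans HK.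
Qed.

Canonical rgraph_equiv := EquivRel rgraph_isob
  rgraph_isob_refl rgraph_isob_sym rgraph_isob_trans.

(* [R] only serves to record where the distance takes its values. *)
Definition rgraph_space (R : realType) : Type := {eq_quot rgraph_equiv}.

HB.instance Definition _ (R : realType) := Choice.on (rgraph_space R).

Definition rgraph_class (R : realType) (G : rgraph) : rgraph_space R :=
  \pi_{eq_quot rgraph_equiv} G.

Definition rgraph_repr (R : realType) (x : rgraph_space R) : rgraph :=
  repr (x : {eq_quot rgraph_equiv}).

Definition rgraph_dist (R : realType) (x y : rgraph_space R) : R :=
  inf [set r.+1%:R^-1 | r in [set r | ball_iso r (rgraph_repr x) (rgraph_repr y)]].

Lemma rgraph_classP (R : realType) (G H : rgraph) :
  rgraph_class R G = rgraph_class R H <-> rgraph_iso G H.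
Proof.
split; first by move=> /eqquotP /asboolP.
by move=> GH; apply/eqquotP/asboolP.
Qed.

Lemma rgraph_reprK (R : realType) (G : rgraph) :
  rgraph_iso (rgraph_repr (rgraph_class R G)) G.
Proof. by apply/(rgraph_classP R); rewrite /rgraph_class /rgraph_repr reprK. Qed.

Lemma rgraph_dist_class (R : realType) (G H : rgraph) :
  rgraph_dist (rgraph_class R G) (rgraph_class R H) =
  inf [set r.+1%:R^-1 | r in [set r | ball_iso r G H]].
Proof.
rewrite /rgraph_dist; congr (inf (image _ _)); apply/seteqP; split=> r /= GH.
- apply: ball_iso_trans (ball_iso_trans GH _).
    exact/ball_iso_sym/rgraph_iso_ball/rgraph_reprK.
  exact/rgraph_iso_ball/rgraph_reprK.
- apply: ball_iso_trans (ball_iso_trans GH _).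
    exact/rgraph_iso_ball/rgraph_reprK.
  exact/ball_iso_sym/rgraph_iso_ball/rgraph_reprK.
Qed.

Section mgraph_space.
Variable E : Type.

HB.instance Definition _ := gen_eqMixin (mgraph E).
HB.instance Definition _ := gen_choiceMixin (mgraph E).

Definition mgraph_isob (G G' : mgraph E) : bool := `[< mgraph_iso G G' >].

Lemma mgraph_isob_refl : reflexive mgraph_isob.
Proof. by move=> G; apply/asboolP; exact: mgraph_iso_refl. Qed.

Lemma mgraph_isob_sym : symmetric mgraph_isob.
Proof. by move=> G H; apply/asboolP/asboolP; exact: mgraph_iso_sym. Qed.

Lemma mgraph_isob_trans : transitive mgraph_isob.
Proof.
by move=> H G K /asboolP GH /asboolP HK; apply/asboolP; exact: mgraph_iso_trans HK.
Qed.

Canonical mgraph_equiv := EquivRel mgraph_isob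
  mgraph_isob_refl mgraph_isob_sym mgraph_isob_trans.

End mgraph_space.

(* Measurable spaces are required to be inhabited, hence [e0]. *)
Definition mgraph_space (R : realType) (E : Type) (e0 : E) : Type :=
  {eq_quot (@mgraph_equiv E)}.

HB.instance Definition _ (R : realType) (E : Type) (e0 : E) :=
  Choice.on (mgraph_space R e0).

Definition mgraph_class (R : realType) (E : Type) (e0 : E) (G : mgraph E) :
  mgraph_space R e0 := \pi_{eq_quot (@mgraph_equiv E)} G.

Definition mgraph_repr (R : realType) (E : Type) (e0 : E)
  (x : mgraph_space R e0) : mgraph E := repr (x : {eq_quot (@mgraph_equiv E)}).

Definition mgraph_dist (R : realType) (E : Type) (e0 : E)
    (x y : mgraph_space R e0) : R :=
  inf [set rj.1.+1%:R^-1 + rj.2.+1%:R^-1 |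
       rj in [set rj | ball_miso rj.1 rj.2 (mgraph_repr x) (mgraph_repr y)]].

Lemma mgraph_classP (R : realType) (E : Type) (e0 : E) (G H : mgraph E) :
  mgraph_class R e0 G = mgraph_class R e0 H <-> mgraph_iso G H.
Proof.
split; first by move=> /eqquotP /asboolP.
by move=> GH; apply/eqquotP/asboolP.
Qed.

Lemma mgraph_reprK (R : realType) (E : Type) (e0 : E) (G : mgraph E) :
  mgraph_iso (mgraph_repr (mgraph_class R e0 G)) G.
Proof. by apply/(mgraph_classP R e0); rewrite /mgraph_class /mgraph_repr reprK. Qed.

Lemma mgraph_dist_class (R : realType) (E : Type) (e0 : E) (G H : mgraph E) :
  mgraph_dist (mgraph_class R e0 G) (mgraph_class R e0 H) =
  inf [set rj.1.+1%:R^-1 + rj.2.+1%:R^-1 | rj in [set rj | ball_miso rj.1 rj.2 G H]].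
Proof.
rewrite /mgraph_dist; congr (inf (image _ _)); apply/seteqP; split=> r /= GH.
- apply: ball_miso_trans (ball_miso_trans GH _).
    exact/ball_miso_sym/mgraph_iso_ball/mgraph_reprK.
  exact/mgraph_iso_ball/mgraph_reprK.
- apply: ball_miso_trans (ball_miso_trans GH _).
    exact/mgraph_iso_ball/mgraph_reprK.
  exact/ball_miso_sym/mgraph_iso_ball/mgraph_reprK.
Qed.

Definition forget_marks (R : realType) (E : Type) (e0 : E)
    (x : mgraph_space R e0) : rgraph_space R :=
  rgraph_class R (mgraph_repr x).

Lemma forget_marks_class (R : realType) (E : Type) (e0 : E) (G : mgraph E) :
  forget_marks (mgraph_class R e0 G) = rgraph_class R G.
Proof. by apply/rgraph_classP/mgraph_iso_rgraph/mgraph_reprK. Qed.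

(* An abstract version of the two distances: [S x y] is the set of levels up to
   which [x] and [y] agree, and [w] decreases along levels. *)
Section agreement_distance.
Context {R : realType} {L : Type} (meet : L -> L -> L) (w : L -> R).
Hypothesis w_ge0 : forall l, 0 <= w l.
Hypothesis w_meet : forall l l', w (meet l l') <= w l + w l'.
Context {X : Type} (S : X -> X -> set L).
Hypothesis S_neq0 : forall x y, S x y !=set0.
Hypothesis S_refl : forall x l, S x x l.
Hypothesis S_sym : forall x y l, S x y l -> S y x l.
Hypothesis S_trans : forall x y z l l', S x y l -> S y z l' -> S x z (meet l l').
Hypothesis w_small : forall e : R, 0 < e -> exists l, w l < e.

Local Notation dist x y := (inf [set w l | l in S x y]).

Let dist_le x y l : S x y l -> dist x y <= w l.
Proof.
move=> Sl; apply: ge_inf; last by exists l.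
by exists 0 => _ [l' _ <-].
Qed.

Lemma agreement_center x (e : R) : 0 < e -> dist x x < e.
Proof. by move=> /w_small[l]; apply: le_lt_trans; exact: dist_le. Qed.

Lemma agreement_sym x y : dist x y = dist y x.
Proof.
by congr (inf (image _ _)); apply/seteqP; split=> l; exact: S_sym.
Qed.

Lemma agreement_triangle x y z : dist x z <= dist x y + dist y z.
Proof.
have nonempty u v : [set w l | l in S u v] !=set0.
  by have [l Sl] := S_neq0 u v; exists (w l), l.
rewrite -lerBlDr; apply: lb_le_inf => // _ [l Sl <-].
rewrite lerBlDr -lerBlDl; apply: lb_le_inf => // _ [l' Sl' <-].
rewrite lerBlDl; apply: le_trans (w_meet l l').
exact/dist_le/(S_trans Sl Sl').
Qed.

End agreement_distance.

Lemma invS_small (R : realType) (e : R) : 0 < e -> exists n : nat, n.+1%:R^-1 < e.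
Proof.
move=> e0; exists (Num.truncn e^-1); rewrite invf_plt ?posrE //.
by have := Num.Theory.truncnS_gt e^-1.
Qed.

Lemma invS_min (R : realType) (r s : nat) :
  (minn r s).+1%:R^-1 <= r.+1%:R^-1 + s.+1%:R^-1 :> R.
Proof. by case: (leqP r s) => _; rewrite ?lerDl ?lerDr invr_ge0. Qed.

Section rgraph_pseudometric.
Variable R : realType.
Implicit Types x y z : rgraph_space R.

Let agree x y := [set r | ball_iso r (rgraph_repr x) (rgraph_repr y)].

Let w (r : nat) : R := r.+1%:R^-1.

Let w_ge0 r : 0 <= w r. Proof. by rewrite invr_ge0. Qed.

Let agree_trans x y z r s : agree x y r -> agree y z s -> agree x z (minn r s).
Proof.
move=> xy yz; apply: ball_iso_trans (ball_iso_mono (geq_minl r s) xy) _.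
exact: ball_iso_mono (geq_minr r s) yz.
Qed.

Let rball x (e : R) : set (rgraph_space R) := [set y | rgraph_dist x y < e].

Let rball_center x (e : R) : 0 < e -> rball x e x.
Proof.
have agree_refl u r : agree u u r by exact: ball_iso_refl.
exact: (agreement_center w_ge0 agree_refl (@invS_small R)).
Qed.

Let rball_sym x y (e : R) : rball x e y -> rball y e x.
Proof.
have agree_sym u v r : agree u v r -> agree v u r by exact: ball_iso_sym.
by have e_sym := agreement_sym w agree_sym x y; rewrite /rball /= /rgraph_dist e_sym.
Qed.

Let rball_triangle x y z (e f : R) : rball x e y -> rball y f z -> rball x (e + f) z.
Proof.
rewrite /rball /= => xy yz; apply: le_lt_trans (ltrD xy yz).
have agree_neq0 u v : agree u v !=set0 by exists 0%N; exact: induced_iso0.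
exact: (agreement_triangle w_ge0 (@invS_min R) agree_neq0 agree_trans).
Qed.

Let rgraph_ent : set_system (rgraph_space R * rgraph_space R) := entourage_ rball.

HB.instance Definition _ := hasNbhs.Build (rgraph_space R) (nbhs_ rgraph_ent).

HB.instance Definition _ := @Nbhs_isPseudoMetric.Build R (rgraph_space R)
  rgraph_ent erefl rball rball_center rball_sym rball_triangle erefl.

Lemma rgraph_ballE x (e : R) : ball x e = [set y | rgraph_dist x y < e].
Proof. by []. Qed.

End rgraph_pseudometric.

Section mgraph_pseudometric.
Variables (R : realType) (E : Type) (e0 : E).
Implicit Types x y z : mgraph_space R e0.

Let agree x y := [set rj | ball_miso rj.1 rj.2 (mgraph_repr x) (mgraph_repr y)].
Let meet (rj si : nat * nat) := (minn rj.1 si.1, minn rj.2 si.2).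

Let w (rj : nat * nat) : R := rj.1.+1%:R^-1 + rj.2.+1%:R^-1.

Let w_ge0 rj : 0 <= w rj. Proof. by rewrite addr_ge0 // invr_ge0. Qed.

Let w_meet rj si : w (meet rj si) <= w rj + w si.
Proof. by rewrite /w addrACA lerD // invS_min. Qed.

Let w_small (e : R) : 0 < e -> exists rj, w rj < e.
Proof.
move=> e0'; have /invS_small[n ne] : 0 < e / 2 by rewrite divr_gt0.
by exists (n, n); rewrite [e]splitr ltrD.
Qed.

Let agree_trans x y z rj si : agree x y rj -> agree y z si -> agree x z (meet rj si).
Proof.
move=> xy yz.
apply: ball_miso_trans (ball_miso_mono (geq_minl _ _) (geq_minl _ _) xy) _.
exact: ball_miso_mono (geq_minr _ _) (geq_minr _ _) yz.
Qed.

Let mball x (e : R) : set (mgraph_space R e0) := [set y | mgraph_dist x y < e].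

Let mball_center x (e : R) : 0 < e -> mball x e x.
Proof.
have agree_refl u rj : agree u u rj by exact: ball_miso_refl.
exact: (agreement_center w_ge0 agree_refl w_small).
Qed.

Let mball_sym x y (e : R) : mball x e y -> mball y e x.
Proof.
have agree_sym u v rj : agree u v rj -> agree v u rj by exact: ball_miso_sym.
by have e_sym := agreement_sym w agree_sym x y; rewrite /mball /= /mgraph_dist e_sym.
Qed.

Let mball_triangle x y z (e f : R) : mball x e y -> mball y f z -> mball x (e + f) z.
Proof.
rewrite /mball /= => xy yz; apply: le_lt_trans (ltrD xy yz).
have agree_neq0 u v : agree u v !=set0 by exists (0%N, 0%N); exact: ball_miso0.
exact: (agreement_triangle w_ge0 w_meet agree_neq0 agree_trans).
Qed.

Let mgraph_ent : set_system (mgraph_space R e0 * mgraph_space R e0) :=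
  entourage_ mball.

HB.instance Definition _ := hasNbhs.Build (mgraph_space R e0) (nbhs_ mgraph_ent).

HB.instance Definition _ := @Nbhs_isPseudoMetric.Build R (mgraph_space R e0)
  mgraph_ent erefl mball mball_center mball_sym mball_triangle erefl.

Lemma mgraph_ballE x (e : R) : ball x e = [set y | mgraph_dist x y < e].
Proof. by []. Qed.

End mgraph_pseudometric.

(* An oriented graph with two distinguished vertices. Edges form a type of their
   own, which makes an edge of [subst G H] below literally a pair (edge of [G],
   edge of [H]); simplicity is the predicate [osimple]. *)
Record ograph := OGraph {
  overt : finType;
  oedge : finType;
  osrc : oedge -> overt;
  otgt : oedge -> overt;
  obeg : overt;
  oend : overt
}.

Definition joins (G : ograph) (e : oedge G) (x y : overt G) : bool :=
  ((osrc e, otgt e) == (x, y)) || ((osrc e, otgt e) == (y, x)).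

Definition oadj (G : ograph) : rel (overt G) := fun x y => [exists e, joins e x y].

Definition osimple (G : ograph) : Prop :=
  (forall e : oedge G, osrc e != otgt e) /\
  (forall (e e' : oedge G) x y, joins e x y -> joins e' x y -> e = e').

Definition oconnected (G : ograph) : Prop := forall x y, connect (@oadj G) x y.

Definition path_uses (G : ograph) (x : overt G) (p : seq (overt G)) (e : oedge G) : bool :=
  has (fun uv => joins e uv.1 uv.2) (zip (x :: p) p).

Definition simple_path (G : ograph) (x y : overt G) (p : seq (overt G)) : Prop :=
  [/\ path (@oadj G) x p, last x p = y & uniq (x :: p)].

Definition two_edge_disjoint_paths (G : ograph) (x y : overt G) : Prop :=
  exists p q, [/\ simple_path x y p, simple_path x y q &
    forall e, ~~ (path_uses x p e && path_uses x q e)].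

Definition inner_vert (H : ograph) : pred (overt H) :=
  fun v => (v != obeg H) && (v != oend H).

Definition subst_overt (G H : ograph) : finType :=
  (overt G + oedge G * {v : overt H | inner_vert v})%type.

(* The vertex [v] of the copy of [H] that replaces [e]. *)
Definition copy_vert (G H : ograph) (e : oedge G) (v : overt H) : subst_overt G H :=
  match insub v with
  | Some w => inr (e, w)
  | None => inl (if v == obeg H then osrc e else otgt e)
  end.

Definition subst (G H : ograph) : ograph :=
  @OGraph (subst_overt G H) (oedge G * oedge H)%type
    (fun e => copy_vert e.1 (osrc e.2)) (fun e => copy_vert e.1 (otgt e.2))
    (inl (obeg G)) (inl (oend G)).

Definition single_edge : ograph :=
  @OGraph bool unit (fun=> false) (fun=> true) false true.

Fixpoint hier (H : ograph) (k : nat) : ograph :=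
  if k is k'.+1 then subst (hier H k') H else single_edge.

Fixpoint address (H : ograph) (k : nat) : oedge (hier H k) -> k.-tuple (oedge H) :=
  match k with
  | 0 => fun=> [tuple]
  | k'.+1 => fun e => [tuple of rcons (address e.1) e.2]
  end.

Section ograph_lemmas.
Implicit Types G H : ograph.

Lemma oadjP G (x y : overt G) : reflect (exists e, joins e x y) (oadj x y).
Proof. exact: fintype.existsP. Qed.

Lemma joins_sym G (e : oedge G) x y : joins e x y = joins e y x.
Proof. by rewrite /joins orbC. Qed.

Lemma joinsE G (e : oedge G) : joins e (osrc e) (otgt e).
Proof. by rewrite /joins eqxx. Qed.

Lemma joins_neq G (e : oedge G) x y : osimple G -> joins e x y -> x != y.
Proof.
by move=> [loopless _] /orP[] /eqP[<- <-]; [|rewrite eq_sym]; exact: loopless.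
Qed.

Lemma oadj_sym G : symmetric (@oadj G).
Proof. by move=> x y; apply/oadjP/oadjP => -[e]; rewrite joins_sym; exists e. Qed.

Lemma oadj_irr G : osimple G -> irreflexive (@oadj G).
Proof.
move=> sG x; case: (boolP (oadj x x)) => // /oadjP[e /(joins_neq sG)].
by rewrite eqxx.
Qed.

Lemma connect_walk (T : finType) (e : rel T) x y : connect e x y -> exists n, walk e x y n.
Proof. by move=> /connectP[p pp ->]; exists (size p), p. Qed.

Lemma copy_outer G H (e : oedge G) (v : overt H) : ~~ inner_vert v ->
  copy_vert e v = inl (if v == obeg H then osrc e else otgt e).
Proof. by move=> nv; rewrite /copy_vert insubN. Qed.

Lemma copy_inner G H (e : oedge G) (v : overt H) (vi : inner_vert v) :
  copy_vert e v = inr (e, Sub v vi).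
Proof. by rewrite /copy_vert insubT. Qed.

Lemma copy_beg G H (e : oedge G) : copy_vert e (obeg H) = inl (osrc e).
Proof. by rewrite copy_outer /inner_vert ?eqxx. Qed.

Lemma copy_end G H (e : oedge G) : obeg H != oend H ->
  copy_vert e (oend H) = inl (otgt e).
Proof.
by move=> ab; rewrite copy_outer /inner_vert ?eqxx ?andbF // eq_sym (negbTE ab).
Qed.

Lemma outer_eq H (u v : overt H) : ~~ inner_vert u -> ~~ inner_vert v ->
  (u == obeg H) = (v == obeg H) -> u = v.
Proof.
rewrite /inner_vert !negb_and !negbK => hu hv huv; move: hu hv; rewrite -huv.
case: (boolP (u == obeg H)) huv => [/eqP-> /esym/eqP-> //|_ _] /=.
by move=> /eqP-> /eqP->.
Qed.

Lemma copy_inj G H (e : oedge G) : osimple G -> injective (@copy_vert G H e).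
Proof.
move=> [loopless _] u v.
case: (boolP (inner_vert u)) => iu; case: (boolP (inner_vert v)) => iv.
- by rewrite !copy_inner => -[].
- by rewrite copy_inner copy_outer.
- by rewrite copy_outer // copy_inner.
- rewrite !copy_outer // => -[] h; apply: outer_eq => //; move: h.
  have := loopless e; do 2 case: (_ == obeg H) => //.
    by move=> + h; rewrite h eqxx.
  by move=> + h; rewrite h eqxx.
Qed.

Lemma subst_joins G H (e : oedge (subst G H)) x y : joins e x y ->
  exists u v, [/\ joins e.2 u v, x = copy_vert e.1 u & y = copy_vert e.1 v].
Proof.
move=> /orP[] /eqP[<- <-]; [exists (osrc e.2), (otgt e.2)|exists (otgt e.2), (osrc e.2)].
  by rewrite joinsE.
by rewrite joins_sym joinsE.
Qed.

Lemma copy_joins G H (e : oedge G) (f : oedge H) u v : joins f u v ->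
  @joins (subst G H) (e, f) (copy_vert e u) (copy_vert e v).
Proof. by move=> /orP[] /eqP[<- <-]; rewrite ?joinsE // joins_sym joinsE. Qed.

Lemma copy_eq G H (e e' : oedge G) (u u' : overt H) :
  copy_vert e u = copy_vert e' u' -> e = e' \/ ~~ inner_vert u /\ ~~ inner_vert u'.
Proof.
case: (boolP (inner_vert u)) => iu; case: (boolP (inner_vert u')) => iu'.
- by rewrite !copy_inner => -[]; left.
- by rewrite copy_inner copy_outer.
- by rewrite copy_outer // copy_inner.
- by right.
Qed.

Lemma outer_joins G H (e : oedge G) (u v : overt H) x y :
  ~~ inner_vert u -> ~~ inner_vert v -> u != v ->
  copy_vert e u = inl x -> copy_vert e v = inl y -> joins e x y.
Proof.
move=> iu iv uv; rewrite !copy_outer // => -[<-] [<-].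
have : (u == obeg H) != (v == obeg H).
  by apply: contra_neq uv => /outer_eq; exact.
case: (u == obeg H); case: (v == obeg H) => //= _; first exact: joinsE.
by rewrite joins_sym joinsE.
Qed.

Lemma subst_simple G H : osimple G -> osimple H -> osimple (subst G H).
Proof.
move=> sG sH; split=> [[e f]|[e f] [e' f'] x y] /=.
  by rewrite (inj_eq (@copy_inj _ H e sG)); exact: sH.1.
move=> /subst_joins[u [v [/= j xu yv]]] /subst_joins[u' [v' [/= j' xu' yv']]].
have uv := joins_neq sH j; have uv' := joins_neq sH j'.
have ee' : e = e'.
  have [//|[iu iu']] := copy_eq (etrans (esym xu) xu').
  have [//|[iv iv']] := copy_eq (etrans (esym yv) yv').
  move: xu yv xu' yv'; rewrite !copy_outer // => -> ->.
  move=> xe ye; apply: (sG.2 e e' _ _ (outer_joins iu iv uv _ _)).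
  - by rewrite copy_outer.
  - by rewrite copy_outer.
  - by apply: (outer_joins iu' iv' uv'); rewrite copy_outer // xe ?ye.
subst e'; congr (_, _).
have uu : u = u' by apply: (copy_inj sG (e := e)); rewrite -xu.
have vv : v = v' by apply: (copy_inj sG (e := e)); rewrite -yv.
by subst u' v'; exact: sH.2 j j'.
Qed.

Lemma subst_connected G H : obeg H != oend H -> oconnected G -> oconnected H ->
  oconnected (subst G H).
Proof.
move=> ab cG cH.
have sym : connect_sym (@oadj (subst G H)) by apply: sym_connect_sym; exact: oadj_sym.
have copy (e : oedge G) (u v : overt H) :
  connect (@oadj (subst G H)) (copy_vert e u) (copy_vert e v).
  have /connectP[p pp ->] := cH u v; elim: p u pp => //= w p IH u /andP[uw pw].
  apply: connect_trans (IH _ pw); apply: connect1.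
  by case/oadjP: uw => f jf; apply/oadjP; exists (e, f); exact: copy_joins.
have edge (e : oedge G) :
  connect (@oadj (subst G H)) (inl (osrc e)) (inl (otgt e)).
  by rewrite -(copy_beg H) -(copy_end _ ab); exact: copy.
have old (x y : overt G) : connect (@oadj (subst G H)) (inl x) (inl y).
  have /connectP[p pp ->] := cG x y; elim: p x pp => //= w p IH x /andP[xw pw].
  apply: connect_trans (IH _ pw); case/oadjP: xw => f /orP[] /eqP[<- <-] //.
  by rewrite sym.
have any (z : overt (subst G H)) : exists x : overt G,
  connect (@oadj (subst G H)) (inl x) z.
  case: z => [x|[e [w iw]]]; first by exists x.
  exists (osrc e); have -> : inr (e, exist _ w iw) = copy_vert e w by rewrite copy_inner.
  by rewrite -(copy_beg H); exact: copy.
move=> z z'; have [x xz] := any z; have [x' xz'] := any z'.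
by rewrite sym in xz; exact: connect_trans xz (connect_trans (old x x') xz').
Qed.

Lemma single_edge_simple : osimple single_edge.
Proof. by split=> // -[] []. Qed.

Lemma single_edge_connected : oconnected single_edge.
Proof.
by case=> -[] //; apply: connect1; apply/oadjP; exists tt.
Qed.

End ograph_lemmas.

Record seed := Seed {
  seed_graph :> ograph;
  seed_simple : osimple seed_graph;
  seed_connected : oconnected seed_graph;
  seed_dist : (1 < gdist (@oadj seed_graph) (obeg seed_graph) (oend seed_graph))%N
}.

Section seed_lemmas.
Variable S : seed.

Lemma seed_neq : obeg S != oend S.
Proof.
apply/negP => /eqP e; have := seed_dist S; rewrite -e ltnNge => /negP; apply.
by apply: leq_trans (gdist_le _) _; last exact: leq0n; exists [::].
Qed.

Lemma seed_edge_gt0 : (0 < #|oedge S|)%N.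
Proof.
have /connectP[[|x p] /=] := seed_connected (obeg S) (oend S).
  by move=> _ e; have := seed_neq; rewrite e eqxx.
by case/andP=> /oadjP[e _] _ _; apply/card_gt0P; exists e.
Qed.

Definition seed_edge : oedge S := enum_val (Ordinal seed_edge_gt0).

Lemma hier_simple k : osimple (hier S k).
Proof.
elim: k => [|k IH]; first exact: single_edge_simple.
exact: subst_simple IH (seed_simple S).
Qed.

Lemma hier_connected k : oconnected (hier S k).
Proof.
elim: k => [|k IH]; first exact: single_edge_connected.
exact: subst_connected seed_neq IH (@seed_connected S).
Qed.

Lemma hier_edge_gt0 k : (0 < #|oedge (hier S k)|)%N.
Proof.
elim: k => [|k IH] /=; first by rewrite card_unit.
by rewrite card_prod muln_gt0 IH seed_edge_gt0.
Qed.

End seed_lemmas.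

(* The vertices of [G] are numbered by [enum_rank]. *)
Section rooted.
Variables (G : ograph) (Gsimple : osimple G) (Gconnected : oconnected G).

Let code (v : overt G) : nat := enum_rank v.

Let decode (i : nat) : option (overt G) := [pick v | code v == i].

Let code_inj : injective code.
Proof. by move=> u v /val_inj /enum_rank_inj. Qed.

Let codeK v : decode (code v) = Some v.
Proof.
rewrite /decode; case: pickP => [w /eqP/code_inj -> //|/(_ v)]; by rewrite eqxx.
Qed.

Let decodeK i v : decode i = Some v -> code v = i.
Proof. by rewrite /decode; case: pickP => // w /eqP <- [->]. Qed.

Definition rooted_adj : rel nat := fun i j =>
  if (decode i, decode j) is (Some x, Some y) then oadj x y else false.

Lemma rooted_adjE x y : rooted_adj (code x) (code y) = oadj x y.
Proof. by rewrite /rooted_adj !codeK. Qed.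

Lemma rooted_adj_vtx i j : rooted_adj i j -> range code i.
Proof.
rewrite /rooted_adj; case di: (decode i) => [v|] // _.
by exists v => //; exact: decodeK.
Qed.

Lemma rooted_adj_sym : symmetric rooted_adj.
Proof.
move=> i j; rewrite /rooted_adj.
by case: (decode i) => [x|]; case: (decode j) => [y|] //; exact: oadj_sym.
Qed.

Lemma rooted_adj_irr : irreflexive rooted_adj.
Proof.
by move=> i; rewrite /rooted_adj; case: (decode i) => [x|] //; exact: oadj_irr.
Qed.

Lemma rooted_conn i j : range code i -> range code j -> exists n, walk rooted_adj i j n.
Proof.
move=> [x _ <-] [y _ <-]; have /connectP[p pp ->] := Gconnected x y.
exists (size p), (map code p); rewrite last_map size_map; split=> //.
by rewrite path_map; apply: sub_path pp => u v /=; rewrite rooted_adjE.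
Qed.

Lemma rooted_locfin i : finite_set [set j | rooted_adj i j].
Proof.
apply: (@sub_finite_set _ _ (range code)).
  by move=> j /=; rewrite rooted_adj_sym; exact: rooted_adj_vtx.
exact/finite_image/finite_finset.
Qed.

Lemma rooted_root (e : oedge G) : rooted_adj (code (osrc e)) (code (otgt e)).
Proof. by rewrite rooted_adjE; apply/oadjP; exists e; exact: joinsE. Qed.

Definition rooted (e : oedge G) : rgraph :=
  @RGraph (range code) rooted_adj (code (osrc e), code (otgt e))
    rooted_adj_vtx rooted_adj_sym rooted_adj_irr rooted_conn rooted_locfin
    (rooted_root e).

Section marked.
Variables (E : Type) (m : oedge G -> mark E) (e : oedge G).

(* [m e] is a dummy, for pairs that are not edges. *)
Definition rooted_mark (i j : nat) : mark E :=
  if (decode i, decode j) is (Some x, Some y) then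
    if [pick f | joins f x y] is Some f then m f else m e
  else m e.

Lemma rooted_mark_sym i j : rooted_mark i j = rooted_mark j i.
Proof.
rewrite /rooted_mark; case: (decode i) => [x|]; case: (decode j) => [y|] //.
by rewrite (eq_pick (fun f => joins_sym f x y)).
Qed.

Lemma rooted_markE (f : oedge G) :
  rooted_mark (code (osrc f)) (code (otgt f)) = m f.
Proof.
rewrite /rooted_mark !codeK; case: pickP => [g j|/(_ f)]; last by rewrite joinsE.
by rewrite (Gsimple.2 _ _ _ _ j (joinsE f)).
Qed.

Definition marked_rooted : mgraph E :=
  @MGraph E (rooted e) rooted_mark rooted_mark_sym.

End marked.
End rooted.

Definition single_rgraph : rgraph :=
  rooted single_edge_simple single_edge_connected tt.

HB.instance Definition _ (R : realType) :=
  isPointed.Build (rgraph_space R) (rgraph_class R single_rgraph).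

Definition single_mgraph (E : Type) (e0 : E) : mgraph E :=
  @MGraph E single_rgraph (fun _ _ => InfWord (fun=> e0)) (fun _ _ => erefl).

HB.instance Definition _ (R : realType) (E : Type) (e0 : E) :=
  isPointed.Build (mgraph_space R e0) (mgraph_class R e0 (single_mgraph e0)).

Definition borel (X : ptopologicalType) := g_sigma_algebraType (@open X).

Section uniform_law.
Context d (X : measurableType d) (R : realType) (T : finType).
Variable g : T -> X.

(* The law of [g t] for [t] uniform in [T]. *)
Definition uniform_law (T0 : (0 < #|T|)%N) : set X -> \bar R :=
  fun A => (#|[pred t | g t \in A]|%:R / #|T|%:R)%:E.

Variable T0 : (0 < #|T|)%N.
Local Notation mu := (uniform_law T0).

Let mu0 : mu set0 = 0%E.
Proof.
rewrite /uniform_law (eq_card0 _) ?mul0r // => t.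
by rewrite inE in_set0.
Qed.

Let mu_ge0 A : (0 <= mu A)%E.
Proof. by rewrite lee_fin divr_ge0. Qed.

Let mu_dirac : mu = mscale (#|T|%:R^-1)%:nng
  (msum (fun i => dirac (g (nth (enum_val (Ordinal T0)) (enum T) i))) #|T|).
Proof.
apply/funext => A; rewrite /mscale /msum /= /uniform_law mulrC EFinM; congr (_ * _)%E.
rewrite /msum /=; move: (enum_val _) => t0.
rewrite -(big_mkord xpredT (fun i => \d_(g (nth t0 (enum T) i)) A)).
rewrite cardT -(big_nth t0 xpredT (fun t => \d_(g t) A)) big_enum /=.
rewrite -sum1_card natr_sum -sumEFin big_mkcond /=; apply: eq_bigr => t _.
by rewrite diracE inE; case: (_ \in _).
Qed.

Let mu_sigma_additive : semi_sigma_additive mu.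
Proof. by rewrite mu_dirac; exact: measure_semi_sigma_additive. Qed.

HB.instance Definition _ := isMeasure.Build _ _ _ mu mu0 mu_ge0 mu_sigma_additive.

Let mu_setT : mu [set: X] = 1%E.
Proof.
rewrite /uniform_law (eq_card (B := predT)); last by move=> t; rewrite inE /= in_setT.
by rewrite divff // pnatr_eq0 -lt0n.
Qed.

HB.instance Definition _ := Measure_isProbability.Build _ _ _ mu mu_setT.

End uniform_law.

Definition cvg_in_distribution (R : realType) (X : ptopologicalType)
    (P_ : nat -> probability (borel X) R) (P : probability (borel X) R) : Prop :=
  forall f : X -> R, continuous f -> (exists M : R, forall x, `|f x| <= M) ->
    (\int[P_ k]_x (f x)%:E)%E @[k --> \oo] --> (\int[P]_x (f x)%:E)%E.

Definition hier_law (R : realType) (S : seed) (k : nat) :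
    probability (borel (rgraph_space R)) R :=
  uniform_law R (X := borel (rgraph_space R))
    (fun e => rgraph_class R (rooted (hier_simple S k) (@hier_connected S k) e))
    (hier_edge_gt0 S k).

(* The level is [k'.+1]: at level [0] the address of the only edge is the empty
   word, which is not a mark. *)
Definition marked_hier_law (R : realType) (S : seed) (k' : nat) :
    probability (borel (mgraph_space R (seed_edge S))) R :=
  uniform_law R (X := borel (mgraph_space R (seed_edge S)))
    (fun e => mgraph_class R (seed_edge S)
      (marked_rooted (hier_simple S k'.+1) (@hier_connected S k'.+1)
        (fun f => FinWord (address f)) e))
    (hier_edge_gt0 S k'.+1).

(* Main.v *)
From HB Require Import structures.
Require Import Defs.
From mathcomp Require Import all_boot all_order all_algebra.
From mathcomp Require Import all_classical all_reals all_analysis.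
From mathcomp Require Import zify measurable_realfun.
Set Implicit Arguments.
Unset Strict Implicit.
Unset Printing Implicit Defensive.
Import Order.TTheory GRing.Theory Num.Theory.
Import numFieldNormedType.Exports.
Local Open Scope classical_set_scope.
Local Open Scope ring_scope.

(** Why the limits exist. Read the address of an edge of [hier S k] from the
    right: the last letters say where the edge sits inside a small block, the
    earlier ones where this block sits inside larger and larger ones. The letters
    of a uniform edge are independent and uniform, so the edges of all levels can
    be drawn together from one infinite uniform word [w]: the edge of level [k]
    has the address [w (k - 1) ... w 0], and passing to level [k.+1] prepends a
    letter. Prepending a letter [d] is an embedding of [hier S k] in
    [hier S k.+1] ([prefix_edge], [prefix_vert]), glued to the rest along the two
    terminals only ([prefix_full]). The levels thus form an increasing chain of
    graphs with a common root, and the limit graph is its union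
    ([limit_mgraph]); the mark of an edge there is its address followed to the
    left by the remaining letters of [w].

    As soon as the ball of radius [r] around the root avoids the terminals of
    [hier S k], it is the same at all later levels and in the union
    ([limit_ball_miso]), and its marks agree up to any number of letters that is
    at most [k]. The point is that this happens almost surely for every [r]
    ([ae_escaping]). Since the terminals of the seed are at distance at least two,
    walks between old vertices shrink by a factor two from one level to the
    previous one ([subst_walk]); so being within distance [r] of a terminal forces
    the ancestor edge, [m] levels up with [r < 2 ^ m], to be incident to that
    terminal. Among the copies of the edges of the seed that replace an incident
    edge, at least one is not incident any more ([card_incident_subst]), because
    no edge of the seed touches both terminals. The proportion of edges close to a
    terminal therefore decays geometrically ([card_near_vert_hier]). This also
    makes the union locally finite.

    Consequently the marked graphs of the levels converge almost surely to the
    limit graph ([level_graph_cvg]), and convergence in distribution follows by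
    dominated convergence ([marked_hier_law_cvg]). The random word is made of the
    digits, in base [#|oedge S|], of a uniform point between 0 and 1. Forgetting the marks
    does not increase distances, so the unmarked statement is the image of the
    marked one ([hier_law_cvg]). *)

(** * Walks *)

Lemma walkSl (T : eqType) (e : rel T) x y n :
  walk e x y n.+1 <-> exists2 z, e x z & walk e z y n.
Proof.
split=> [[[|z p] [//= /andP[xz pz] l [s]]]|[z xz [p [pz l s]]]].
  by exists z => //; exists p.
by exists (z :: p); rewrite /= xz s.
Qed.

Lemma walkSr (T : eqType) (e : rel T) x y n :
  walk e x y n.+1 <-> exists2 z, walk e x z n & e z y.
Proof.
split=> [[p [+ + +]]|[z [p [pz l s]] zy]].
  case/lastP: p => // p z; rewrite rcons_path last_rcons size_rcons.
  by move=> /andP[pz zy] <- [s]; exists (last x p) => //; exists p.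
by exists (rcons p y); rewrite rcons_path last_rcons size_rcons pz l s.
Qed.

Lemma walk_map (T T' : eqType) (e : rel T) (e' : rel T') (f : T -> T') :
  (forall u v, e u v -> e' (f u) (f v)) ->
  forall x y n, walk e x y n -> walk e' (f x) (f y) n.
Proof.
move=> h x y n; elim: n y => [|n IH] y.
  by move=> [p [_ <- /size0nil ->]]; exists [::].
by move=> /walkSr[z /IH w /h zy]; apply/walkSr; exists (f z).
Qed.

(** If every edge at the image of a vertex of [P] comes from the source graph,
    a walk whose source-side vertices stay in [P] never sees the rest of the
    target graph. This is why a ball that avoids the two terminals of a block is
    the same inside the block and inside any larger graph. *)
Lemma walk_lift (T T' : eqType) (e : rel T) (e' : rel T') (f : T -> T') (P : pred T) :
  (forall u y', P u -> e' (f u) y' -> exists2 v, y' = f v & e u v) ->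
  forall r x, (forall v n, (n <= r)%N -> walk e x v n -> P v) ->
  forall n y', (n <= r)%N -> walk e' (f x) y' n -> exists2 y, y' = f y & walk e x y n.
Proof.
move=> h r x xP; elim=> [|n IH] y' nr.
  by move=> [p [_ <- /size0nil ->]]; exists x => //; exists [::].
move=> /walkSr[z' /(IH _ (ltnW nr))[z -> w] zy'].
have [y -> zy] := h _ _ (xP _ _ (ltnW nr) w) zy'.
by exists y => //; apply/walkSr; exists z.
Qed.

(** * Edges close to a terminal *)

Section near.
Implicit Types (G : ograph) (S : seed).

Definition near_vert G (y : overt G) (r : nat) : pred (oedge G) := fun e =>
  `[< exists2 n, (n <= r)%N & walk (@oadj G) (osrc e) y n \/ walk (@oadj G) (otgt e) y n >].

Lemma near_vertP G (y : overt G) r e : reflect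
  (exists2 n, (n <= r)%N & walk (@oadj G) (osrc e) y n \/ walk (@oadj G) (otgt e) y n)
  (near_vert y r e).
Proof. exact: asboolP. Qed.

Lemma near_vert0 G (y : overt G) e : near_vert y 0 e = (y == osrc e) || (y == otgt e).
Proof.
apply/near_vertP/orP => [[n]|].
  rewrite leqn0 => /eqP-> [] [p [_ <- /size0nil ->]]; rewrite eqxx; by [left|right].
by case=> /eqP->; exists 0%N => //; [left|right]; exists [::].
Qed.

Lemma seed_joins_inner S (f : oedge S) u v : joins f u v -> inner_vert u || inner_vert v.
Proof.
move=> j; apply: contraT; rewrite negb_or => /andP[iu iv].
have far (x y : overt S) : joins f x y -> x = obeg S -> y = oend S -> False.
  move=> jxy xa yb; have := seed_dist S; rewrite ltnNge => /negP; apply.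
  apply: gdist_le; exists [:: y]; rewrite -xa yb; split=> //=; rewrite andbT.
  by apply/oadjP; exists f; rewrite -yb.
have uv := joins_neq (seed_simple S) j.
move: iu iv; rewrite /inner_vert !negb_and !negbK => /orP[]/eqP ue /orP[]/eqP ve.
- by rewrite ue ve eqxx in uv.
- by case: (far _ _ j ue ve).
- by rewrite joins_sym in j; by case: (far _ _ j ve ue).
- by rewrite ue ve eqxx in uv.
Qed.

(** Since the terminals of the seed are at distance at least two, crossing a
    copy of the seed costs at least two steps, so a walk of [subst G S] projects
    to a walk of [G] of at most half its length. *)
Lemma subst_walk G S (y : overt G) n (z : overt (subst G S)) :
  walk (@oadj (subst G S)) z (inl y) n ->
  match z with
  | inl x => exists2 m, (m.*2 <= n)%N & walk (@oadj G) x y m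
  | inr ew => exists2 m, (m.*2 < n)%N &
      walk (@oadj G) (osrc ew.1) y m \/ walk (@oadj G) (otgt ew.1) y m
  end.
Proof.
elim: n z => [|n IH] z.
  move=> [p [_ pz /size0nil p0]]; move: pz; rewrite p0 /= => ->.
  by exists 0%N => //; exists [::].
move=> /walkSl[z' /oadjP[[e f] /subst_joins[u [v [/= j -> ->]]]] /IH].
have := seed_joins_inner j.
case: (boolP (inner_vert u)) => iu; case: (boolP (inner_vert v)) => iv // _.
- by rewrite (copy_inner _ iu) (copy_inner _ iv) => -[m mn w]; exists m => //; exact: ltnW.
- rewrite (copy_inner _ iu) copy_outer // => -[m mn w]; exists m => //.
  by move: w; case: ifP => _ w; [left|right].
- rewrite (copy_inner _ iv) copy_outer //= => -[m mn].
  have st : oadj (osrc e) (otgt e) by apply/oadjP; exists e; exact: joinsE.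
  have ts : oadj (otgt e) (osrc e) by rewrite oadj_sym.
  have same : (m.*2 <= n.+1)%N by exact: leq_trans (ltnW mn) _.
  have next : (m.+1.*2 <= n.+1)%N by rewrite doubleS.
  case: ifP => _ [] w; [exists m|exists m.+1|exists m.+1|exists m] => //;
    by apply/walkSl; eexists; last exact: w.
Qed.

Lemma near_vert_subst G S (y : overt G) r (e : oedge G) (f : oedge S) :
  near_vert (G := subst G S) (inl y) r (e, f) -> near_vert y r./2 e.
Proof.
have half m n : (m.*2 <= n)%N -> (n <= r)%N -> (m <= r./2)%N.
  by move=> mn nr; rewrite geq_half_double; exact: leq_trans nr.
move=> /near_vertP[n nr w].
have {w} [u /subst_walk] : exists u, walk (@oadj (subst G S)) (copy_vert e u) (inl y) n.
  by case: w => w; eexists; exact: w.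
case: (boolP (inner_vert u)) => iu.
  rewrite (copy_inner _ iu) => -[m mn w]; apply/near_vertP; exists m => //.
  exact: half (ltnW mn) nr.
rewrite copy_outer // => -[m mn w]; apply/near_vertP; exists m; first exact: half mn nr.
by move: w; case: ifP => _ w; [left|right].
Qed.

Lemma card_near_vert_subst G S (y : overt G) r :
  (#|near_vert (G := subst G S) (inl y) r| <= #|near_vert y r./2| * #|oedge S|)%N.
Proof.
rewrite -(cardX (near_vert y r./2) predT); apply: subset_leq_card.
by apply/fintype.subsetP => -[e f] /near_vert_subst h; rewrite inE /= andbT.
Qed.

Lemma seed_edge_at S (x : overt S) : exists f : oedge S, x = osrc f \/ x = otgt f.
Proof.
have [y xy] : exists y, x != y.
  case: (eqVneq x (obeg S)) => [->|h]; last by exists (obeg S).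
  by exists (oend S); exact: seed_neq.
have /connectP[[|z p] /=] := seed_connected x y.
  by move=> _ e; rewrite e eqxx in xy.
by move=> /andP[/oadjP[f /orP[]/eqP[<- <-]] _] _; exists f; [left|right].
Qed.

(** An edge of [S] at one terminal misses the other terminal; so among the
    copies of the edges of [S] that replace an edge at [y], at least one is not
    incident to [y] any more. *)
Lemma card_incident_subst G S (y : overt G) : osimple G ->
  (#|near_vert (G := subst G S) (inl y) 0| <= #|near_vert y 0| * #|oedge S|.-1)%N.
Proof.
move=> Gsimple.
have ex (e : oedge G) : exists f : oedge S,
    near_vert y 0 e -> ~~ near_vert (G := subst G S) (inl y) 0 (e, f).
  have miss (x x' : overt S) : x = obeg S /\ x' = oend S \/ x = oend S /\ x' = obeg S ->
      inl y = copy_vert e x :> overt (subst G S) ->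
    exists f : oedge S, ~~ near_vert (G := subst G S) (inl y) 0 (e, f).
    move=> xx' yx; have [f fx'] := seed_edge_at x'; exists f.
    rewrite near_vert0 /= yx !(inj_eq (@copy_inj _ _ e Gsimple)) negb_or.
    have ix : ~~ inner_vert x.
      by rewrite /inner_vert; case: xx' => -[-> _]; rewrite eqxx ?andbF.
    have ix' : ~~ inner_vert x'.
      by rewrite /inner_vert; case: xx' => -[_ ->]; rewrite eqxx ?andbF.
    have xx : x != x' by case: xx' => -[-> ->]; rewrite ?seed_neq // eq_sym seed_neq.
    have jf := joinsE f; case: fx' => fx'.
      rewrite -fx' xx /=; apply: contraNneq ix => ->.
      by have := seed_joins_inner jf; rewrite -fx' (negbTE ix').
    rewrite -fx' xx andbT; apply: contraNneq ix => ->.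
    by have := seed_joins_inner jf; rewrite -fx' (negbTE ix') orbF.
  case: (boolP (near_vert y 0 e)) => [|_]; last by exists (seed_edge S).
  rewrite near_vert0 => /orP[]/eqP ye.
    have [|f ?] := miss (obeg S) (oend S) (or_introl (conj erefl erefl)); last by exists f.
    by rewrite copy_beg ye.
  have [|f ?] := miss (oend S) (obeg S) (or_intror (conj erefl erefl)); last by exists f.
  by rewrite copy_end ?seed_neq // ye.
have [f0 f0P] := boolp.choice ex.
set A := near_vert _ _; set B := near_vert _ _.
(* [C] collects one missing copy for every edge at [y] *)
pose C : pred (oedge (subst G S)) := fun ef => B ef.1 && (ef.2 == f0 ef.1).
have AC : #|predI A C| = 0%N.
  apply: eq_card0 => -[e f]; apply/negP => /andP[Ae /andP[Be /eqP/= fe]].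
  by have /negP := f0P e Be; rewrite -fe; apply; exact: Ae.
have cardC : #|C| = #|B|.
  have inj : injective (fun e : oedge G => (e, f0 e)) by move=> e e' [].
  rewrite -(fintype.card_image inj B); apply: eq_card => -[e f].
  apply/idP/fintype.imageP => [/andP[/= Be /eqP->]|[e' Be' [-> ->]]]; first by exists e.
  by rewrite unfold_in /C /= eqxx andbT.
have : (#|predU A C| <= #|B| * #|oedge S|)%N.
  rewrite -(cardX B predT); apply: subset_leq_card.
  apply/fintype.subsetP => -[e f] /orP[/near_vert_subst h|/andP[h _]];
    by rewrite inE /= andbT.
rewrite -[#|predU A C|](addnK #|predI A C|) cardUI AC subn0 cardC.
rewrite -[#|oedge S| in X in (X -> _)](prednK (seed_edge_gt0 S)) mulnS.
by rewrite addnC leq_add2l.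
Qed.

(** After [m] halvings a radius below [2 ^ m] has become zero, and each of the
    [k] coarser levels loses one edge out of [#|oedge S|]: the proportion of edges
    within a fixed distance of a terminal decays geometrically. *)
Lemma card_near_vert_hier S (y : forall k, overt (hier S k)) :
  (forall k, y k.+1 = inl (y k)) -> forall m k r, (r < 2 ^ m)%N ->
  (#|near_vert (y (m + k)%N) r| <= #|oedge S| ^ m * #|oedge S|.-1 ^ k)%N.
Proof.
move=> yS; elim=> [|m IH] k r.
  rewrite ltnS leqn0 => /eqP->; rewrite mul1n add0n.
  elim: k => [|k IH]; first by rewrite expn0 -card_unit; exact: max_card.
  rewrite yS expnSr; apply: leq_trans (card_incident_subst _ _ (hier_simple S k)) _.
  by rewrite leq_mul2r IH orbT.
move=> rm; rewrite addSn yS; apply: leq_trans (card_near_vert_subst _ _ _) _.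
rewrite expnSr mulnAC leq_mul2r IH ?orbT //.
by rewrite ltn_half_double -mul2n -expnS.
Qed.

Definition deep G (r : nat) (e : oedge G) :=
  ~~ near_vert (obeg G) r e && ~~ near_vert (oend G) r e.

Lemma deepP G r (e : oedge G) : reflect
  (forall x v n, x = osrc e \/ x = otgt e -> (n <= r)%N -> walk (@oadj G) x v n ->
     inner_vert v)
  (deep r e).
Proof.
apply: (iffP andP) => [[na nb] x v n xe nr w|h].
  apply/andP; split.
    apply: contraNneq na => va; apply/near_vertP; exists n => //.
    by case: xe w => -> w; [left|right]; rewrite -va.
  apply: contraNneq nb => vb; apply/near_vertP; exists n => //.
  by case: xe w => -> w; [left|right]; rewrite -vb.
split; apply/negP => /near_vertP[n nr [] w];
  by [have := h _ _ _ (or_introl erefl) nr w; rewrite /inner_vert eqxx ?andbF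
     |have := h _ _ _ (or_intror erefl) nr w; rewrite /inner_vert eqxx ?andbF].
Qed.

End near.

(** * Prepending a letter to an address *)

(** The copies of [hier S k] inside [hier S k.+1]: the edge of address [c] is sent
    to the edge of address [d :: c]. The recursion follows [hier], which refines
    edges instead of replacing the edges of the seed by copies of [hier S k]; so
    the copy indexed by [d] is built by refining one edge of the seed [k] times. *)
Fixpoint prefix_edge (H : ograph) k (d : oedge H) :
    oedge (hier H k) -> oedge (hier H k.+1) :=
  match k return oedge (hier H k) -> oedge (hier H k.+1) with
  | 0 => fun e => (e, d)
  | k'.+1 => fun e => (prefix_edge d e.1, e.2)
  end.

Fixpoint prefix_vert (H : ograph) k (d : oedge H) :
    overt (hier H k) -> overt (hier H k.+1) :=
  match k return overt (hier H k) -> overt (hier H k.+1) with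
  | 0 => fun v => @copy_vert single_edge H tt (if v then otgt d else osrc d)
  | k'.+1 => fun v => match v with
             | inl x => inl (prefix_vert d x)
             | inr ew => inr (prefix_edge d ew.1, ew.2)
             end
  end.

Section prefix.
Variable S : seed.
Implicit Types (k : nat) (d : oedge S).

Lemma prefix_src_tgt k d (e : oedge (hier S k)) :
  osrc (prefix_edge d e) = prefix_vert d (osrc e) /\
  otgt (prefix_edge d e) = prefix_vert d (otgt e).
Proof.
elim: k e => [|k IH] /= => [[] //|[e f] /=].
have copy u : copy_vert (prefix_edge d e) u =
    prefix_vert (k := k.+1) d (copy_vert (G := hier S k) e u).
  case: (boolP (inner_vert u)) => iu; first by rewrite !(copy_inner _ iu).
  have [s t] := IH e; rewrite !copy_outer //=.
  by case: (u == obeg S); congr inl; [exact: s|exact: t].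
by split; exact: copy.
Qed.

Lemma prefix_copy k d (e : oedge (hier S k)) (u : overt S) :
  copy_vert (prefix_edge d e) u =
    prefix_vert (k := k.+1) d (copy_vert (G := hier S k) e u).
Proof.
case: (boolP (inner_vert u)) => iu; first by rewrite !(copy_inner _ iu).
have [s t] := prefix_src_tgt d e; rewrite !copy_outer //=.
by case: (u == obeg S); congr inl; [exact: s|exact: t].
Qed.

Lemma prefix_edge_inj k d d' (e e' : oedge (hier S k)) :
  prefix_edge d e = prefix_edge d' e' -> d = d' /\ e = e'.
Proof.
elim: k e e' => [[] [] [->] //|k IH [e f] [e' f']].
by move=> /= [/IH[-> ->] ->].
Qed.

Lemma prefix_edge_surj k (e : oedge (hier S k.+1)) :
  exists d e', e = prefix_edge d e'.
Proof.
elim: k e => [[[] f]|k IH [e f]]; first by exists f, tt.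
by have [d [e' ->]] := IH e; exists d, (e', f).
Qed.

Lemma address_prefix k d (e : oedge (hier S k)) :
  address (prefix_edge d e) = d :: address e :> seq _.
Proof. by elim: k e => [[]//|k IH [e f]] /=; rewrite IH. Qed.

Lemma prefix_vert_inj k d : injective (@prefix_vert S k d).
Proof.
elim: k => [|k IH].
  move=> u v /(copy_inj single_edge_simple) /=; have /eqP := (seed_simple S).1 d.
  by case: u; case: v => // h /esym.
move=> [x|[e w]] [x'|[e' w']] //= [].
  by move=> /IH ->.
by move=> /prefix_edge_inj[_ ->] ->.
Qed.

Lemma prefix_joins k d (e : oedge (hier S k)) u v :
  joins e u v -> joins (prefix_edge d e) (prefix_vert d u) (prefix_vert d v).
Proof.
have [s t] := prefix_src_tgt d e.
by move=> /orP[]/eqP[<- <-]; rewrite /joins s t eqxx ?orbT.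
Qed.

Lemma prefix_inner k d (v : overt (hier S k)) :
  inner_vert v -> inner_vert (prefix_vert d v).
Proof.
elim: k v => [[]//|k IH] [x|//].
by rewrite /inner_vert /= => /IH.
Qed.

(** A copy of [hier S k] is glued to the rest only along its two terminals: an edge
    at an old inner vertex refines an edge that was already at this vertex, and a
    vertex created by the last refinement only meets edges of its own copy of the
    seed. *)
Lemma prefix_full k d (u : overt (hier S k)) (e' : oedge (hier S k.+1)) y' :
  inner_vert u -> joins e' (prefix_vert d u) y' ->
  exists e v, [/\ e' = prefix_edge d e, y' = prefix_vert d v & joins e u v].
Proof.
elim: k u e' y' => [[]//|k IH] u [e' f] y' iu j.
have [a [b [/= jab ua yb]]] := subst_joins j.
have [e ee] : exists e, e' = prefix_edge d e.
  case: u iu ua {j} => [x|[e w]] iu /=; last first.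
    case: (boolP (inner_vert a)) => ia; last by rewrite copy_outer.
    by rewrite (copy_inner _ ia) => -[<- _]; exists e.
  case: (boolP (inner_vert a)) => ia; first by rewrite (copy_inner _ ia).
  rewrite copy_outer // => -[xe].
  have [z jz] : exists z, joins e' (prefix_vert d x) z.
    rewrite xe; case: ifP => _; first by exists (otgt e'); exact: joinsE.
    by exists (osrc e'); rewrite joins_sym joinsE.
  by have [e [_ [-> _ _]]] := IH x e' z iu jz; exists e.
subst e'; exists (e, f), (copy_vert e b); split=> //.
  by rewrite yb prefix_copy.
have -> : u = copy_vert e a.
  apply: (@prefix_vert_inj k.+1 d).
  by apply: etrans (prefix_copy _ _ _); exact: ua.
exact: copy_joins.
Qed.

Lemma prefix_oadj k d (u v : overt (hier S k)) :
  oadj u v -> oadj (prefix_vert d u) (prefix_vert d v).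
Proof. by move=> /oadjP[e /(prefix_joins d) j]; apply/oadjP; eexists; exact: j. Qed.

Lemma prefix_oadj_full k d (u : overt (hier S k)) y' :
  inner_vert u -> oadj (prefix_vert d u) y' ->
  exists2 v, y' = prefix_vert d v & oadj u v.
Proof.
move=> iu /oadjP[e' /(prefix_full iu)[e [v [_ -> j]]]]; exists v => //.
by apply/oadjP; exists e.
Qed.

Lemma prefix_deep k d r (e : oedge (hier S k)) : deep r e -> deep r (prefix_edge d e).
Proof.
move=> /deepP h; apply/deepP => x v n xe nr w.
have [s t] := prefix_src_tgt d e.
have [x0 x0e xx0] : exists2 x0, x0 = osrc e \/ x0 = otgt e & x = prefix_vert d x0.
  by rewrite s t in xe; case: xe => ->; eexists; [left|reflexivity|right|reflexivity].
rewrite xx0 in w.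
have [y -> wy] := walk_lift (@prefix_oadj_full k d) (fun v n => h x0 v n x0e) nr w.
exact/prefix_inner/(h x0 y n).
Qed.

End prefix.

(** * The limit along an infinite word *)

HB.instance Definition _ (E : Type) := gen_eqMixin (mark E).
HB.instance Definition _ (E : Type) := gen_choiceMixin (mark E).

Section limit.
Variables (S : seed) (w : nat -> oedge S).

Fixpoint branch_edge k : oedge (hier S k) :=
  if k is k'.+1 then prefix_edge (w k') (branch_edge k') else tt.

Definition vert_code k (v : overt (hier S k)) : nat :=
  pickle (k, nat_of_ord (enum_rank v)).

(** The vertices of the increasing union: a vertex of [hier S k] keeps the number
    it received at the first level where it appears. *)
Fixpoint limit_vert k : overt (hier S k) -> nat :=
  match k return overt (hier S k) -> nat with
  | 0 => @vert_code 0
  | k'.+1 => fun u => if [pick v | prefix_vert (w k') v == u] is Some v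
                      then limit_vert v else vert_code u
  end.

Lemma limit_prefix k (v : overt (hier S k)) :
  limit_vert (prefix_vert (w k) v) = limit_vert v.
Proof.
rewrite [LHS]/=; case: pickP => [v' /eqP/prefix_vert_inj -> //|/(_ v)].
by rewrite eqxx.
Qed.

Lemma vert_code_inj k : injective (@vert_code k).
Proof. by move=> u v /(pcan_inj pickleK_inv)[] /val_inj/enum_rank_inj. Qed.

Lemma limit_vert_code k (v : overt (hier S k)) :
  exists l (u : overt (hier S l)), (l <= k)%N /\ limit_vert v = vert_code u.
Proof.
elim: k v => [|k IH] v; first by exists 0%N, v.
rewrite /=; case: pickP => [u _|_]; last by exists k.+1, v.
by have [l [u' [lk ->]]] := IH u; exists l, u'; rewrite leqW.
Qed.

Lemma limit_vert_inj k : injective (@limit_vert k).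
Proof.
elim: k => [|k IH]; first exact: vert_code_inj.
have old_new (u : overt (hier S k)) (v : overt (hier S k.+1)) :
    limit_vert u <> vert_code v.
  have [l [u' [lk ->]]] := limit_vert_code u.
  by move=> /(pcan_inj pickleK_inv)[lk1]; rewrite lk1 ltnn in lk.
move=> u v /=; case: pickP => [u' /eqP<-|_]; case: pickP => [v' /eqP<-|_].
- by move=> /IH ->.
- by move=> /old_new.
- by move=> /esym/old_new.
- exact: vert_code_inj.
Qed.

Lemma limit_lift k l (v : overt (hier S k)) : (k <= l)%N ->
  exists v' : overt (hier S l),
    limit_vert v' = limit_vert v /\ (inner_vert v -> inner_vert v').
Proof.
move=> kl; have {kl} [m ->] : exists m, l = (m + k)%N by exists (l - k)%N; rewrite subnK.
elim: m => [|m [u [ue ui]]]; first by exists v.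
by exists (prefix_vert (w (m + k)) u); rewrite limit_prefix; split=> // /ui/prefix_inner.
Qed.

Definition limit_adj : rel nat := fun x y =>
  `[< exists k (u v : overt (hier S k)),
        [/\ limit_vert u = x, limit_vert v = y & oadj u v] >].

Lemma limit_adjP x y : reflect
  (exists k (u v : overt (hier S k)), [/\ limit_vert u = x, limit_vert v = y & oadj u v])
  (limit_adj x y).
Proof. exact: asboolP. Qed.

(** The letters of the infinite address, read from the right: first those of the
    address inside [hier S k], then those of the word. *)
Definition limit_letters k (e : oedge (hier S k)) (i : nat) : oedge S :=
  if (i < k)%N then nth (seed_edge S) (rev (address e)) i else w i.

Lemma limit_letters_prefix k (e : oedge (hier S k)) :
  limit_letters (prefix_edge (w k) e) = limit_letters e.
Proof.
apply/funext => i; rewrite /limit_letters address_prefix rev_cons nth_rcons.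
by rewrite size_rev size_tuple ltnS; case: ltngtP => // ->.
Qed.

Lemma limit_joins_lift k l (e : oedge (hier S k)) u v : (k <= l)%N -> joins e u v ->
  exists (e' : oedge (hier S l)) u' v',
   [/\ limit_vert u' = limit_vert u, limit_vert v' = limit_vert v, joins e' u' v' &
       limit_letters e' = limit_letters e].
Proof.
move=> kl j; have {kl} [m ->] : exists m, l = (m + k)%N by exists (l - k)%N; rewrite subnK.
elim: m => [|m [e' [u' [v' [<- <- j' <-]]]]]; first by exists e, u, v.
exists (prefix_edge (w (m + k)) e'), (prefix_vert (w (m + k)) u'),
  (prefix_vert (w (m + k)) v').
by rewrite !limit_prefix limit_letters_prefix; split=> //; exact: prefix_joins.
Qed.

Lemma limit_oadj k (u v : overt (hier S k)) :
  oadj u v -> limit_adj (limit_vert u) (limit_vert v).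
Proof. by move=> uv; apply/limit_adjP; exists k, u, v. Qed.

(** At an inner vertex of [hier S k] the limit has no further edge: the edges seen
    at a later level are pulled back one level at a time. *)
Lemma limit_adj_full k (u : overt (hier S k)) y : inner_vert u ->
  limit_adj (limit_vert u) y -> exists2 v, y = limit_vert v & oadj u v.
Proof.
move=> iu /limit_adjP[l0 [u0 [v0 [uu0 <- /oadjP[e0 j0]]]]].
have [e [u1 [v1 [u1e <- j1 _]]]] := limit_joins_lift (leq_addr k l0) j0.
have {e j1} : oadj u1 v1 by apply/oadjP; exists e.
rewrite {}uu0 in u1e.
move: (l0 + k)%N (leq_addl l0 k) u1 v1 u1e => {u0 v0 e0 j0} l.
elim: l => [|l IH] kl u1 v1 uu1 a1.
  move: u iu uu1; have -> : k = 0%N by apply/eqP; rewrite -leqn0.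
  by case.
move: kl; rewrite leq_eqVlt => /orP[/eqP kl|kl].
  subst k; exists v1 => //.
  by move: uu1 => /limit_vert_inj <-.
have [u2 [u2e /(_ iu) iu2]] := limit_lift u kl.
have u1E : u1 = prefix_vert (w l) u2 by apply: limit_vert_inj; rewrite limit_prefix u2e.
rewrite u1E in a1; have [v2 -> a2] := prefix_oadj_full iu2 a1.
by rewrite limit_prefix; exact: IH a2.
Qed.

Lemma limit_adj_sym : symmetric limit_adj.
Proof.
by move=> x y; apply/limit_adjP/limit_adjP => -[k [u [v [<- <- a]]]];
  exists k, v, u; rewrite oadj_sym.
Qed.

Lemma limit_adj_irr : irreflexive limit_adj.
Proof.
move=> x; apply/negP => /limit_adjP[k [u [v [<- /limit_vert_inj -> a]]]].
by rewrite (oadj_irr (hier_simple S k)) in a.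
Qed.

Definition limit_vtx : set nat := [set x | exists k (u : overt (hier S k)), limit_vert u = x].

Lemma limit_adj_vtx x y : limit_adj x y -> limit_vtx x.
Proof. by move=> /limit_adjP[k [u [_ [<- _ _]]]]; exists k, u. Qed.

Lemma limit_conn x y : limit_vtx x -> limit_vtx y -> exists n, walk limit_adj x y n.
Proof.
move=> [k [u <-]] [l [v <-]].
have [u' [<- _]] := limit_lift u (leq_addr l k).
have [v' [<- _]] := limit_lift v (leq_addl k l).
have /connect_walk[n wn] := @hier_connected S _ u' v'.
by exists n; apply: walk_map wn => a b; exact: limit_oadj.
Qed.

(** The root escapes from the terminals; this happens for almost every word. *)
Definition escaping := forall r, exists k, deep r (branch_edge k).

Lemma deep_branch_mono r k l : (k <= l)%N ->
  deep r (branch_edge k) -> deep r (branch_edge l).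
Proof.
move=> kl dk; have {kl} -> : l = (l - k + k)%N by rewrite subnK.
by elim: (l - k)%N => [//|m IH]; exact: prefix_deep.
Qed.

Lemma limit_branch k :
  limit_vert (osrc (branch_edge k)) = limit_vert (osrc (branch_edge 0)) /\
  limit_vert (otgt (branch_edge k)) = limit_vert (otgt (branch_edge 0)).
Proof.
elim: k => [//|k [<- <-]] /=.
have [s t] := prefix_src_tgt (w k) (branch_edge k).
by rewrite -(limit_prefix (osrc _)) -(limit_prefix (otgt _)) -s -t.
Qed.

Lemma escaping_inner k (u : overt (hier S k)) : escaping ->
  exists l (u' : overt (hier S l)), limit_vert u' = limit_vert u /\ inner_vert u'.
Proof.
move=> esc.
have /connect_walk[n wn] := @hier_connected S _ (osrc (branch_edge k)) u.
have [l dl] := esc n.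
have [u' [u'e _]] := limit_lift u (leq_addr l k).
exists (k + l)%N, u'; split=> //.
(* the distance from the root can only decrease along the embeddings *)
have {wn} : exists v, limit_vert v = limit_vert u /\
    walk (@oadj (hier S (l + k))) (osrc (branch_edge (l + k))) v n.
  elim: l {dl u' u'e} => [|l [v [ve wv]]]; first by exists u.
  exists (prefix_vert (w (l + k)) v); rewrite limit_prefix; split=> //.
  have -> : osrc (branch_edge (l.+1 + k)) =
      prefix_vert (w (l + k)) (osrc (branch_edge (l + k))).
    exact: (prefix_src_tgt _ _).1.
  by apply: walk_map wv; exact: prefix_oadj.
rewrite addnC => -[v [ve wv]].
have -> : u' = v by apply: limit_vert_inj; rewrite u'e ve.
have /deepP := deep_branch_mono (leq_addl k l) dl.
by apply; [left|exact: leqnn|exact: wv].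
Qed.

Lemma limit_locfin : escaping -> forall x, finite_set [set y | limit_adj x y].
Proof.
move=> esc x; case: (pselect (limit_vtx x)) => [[k [u <-]]|nx]; last first.
  suff -> : [set y | limit_adj x y] = set0 by exact: finite_set0.
  by apply/seteqP; split=> // y /limit_adj_vtx.
have [l [u' [<- iu']]] := escaping_inner u esc.
apply: (@sub_finite_set _ _ (range (@limit_vert l))).
  by move=> y /= /(limit_adj_full iu')[v -> _]; exists v.
exact/finite_image/finite_finset.
Qed.

Lemma limit_root_adj :
  limit_adj (limit_vert (osrc (branch_edge 0))) (limit_vert (otgt (branch_edge 0))).
Proof. by apply: limit_oadj; apply/oadjP; exists tt. Qed.

Definition limit_rgraph (esc : escaping) : Defs.rgraph :=
  @RGraph limit_vtx limit_adj
    (limit_vert (osrc (branch_edge 0)), limit_vert (otgt (branch_edge 0)))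
    limit_adj_vtx limit_adj_sym limit_adj_irr limit_conn (limit_locfin esc)
    limit_root_adj.

Definition limit_mark (x y : nat) : mark (oedge S) :=
  xget (InfWord (fun=> seed_edge S))
    [set m | exists k (e : oedge (hier S k)) u v,
      [/\ limit_vert u = x, limit_vert v = y, joins e u v & m = InfWord (limit_letters e)]].

Lemma limit_mark_sym x y : limit_mark x y = limit_mark y x.
Proof.
rewrite /limit_mark; congr xget; apply/seteqP; split=> m [k [e [u [v [ux vy j ->]]]]];
  by exists k, e, v, u; rewrite joins_sym.
Qed.

(** All the occurrences of an edge of the union, one at each level from the first
    on, have the same infinite address. *)
Lemma limit_letters_uniq k l (e : oedge (hier S k)) (e' : oedge (hier S l)) u v u' v' :
  joins e u v -> joins e' u' v' ->
  limit_vert u = limit_vert u' -> limit_vert v = limit_vert v' ->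
  limit_letters e = limit_letters e'.
Proof.
move=> /(limit_joins_lift (leq_addr l k))[f [x [y [<- <- j <-]]]].
move=> /(limit_joins_lift (leq_addl k l))[f' [x' [y' [<- <- j' <-]]]].
move=> /limit_vert_inj xx /limit_vert_inj yy; subst x' y'.
by rewrite ((hier_simple S _).2 _ _ _ _ j j').
Qed.

Lemma limit_markE k (e : oedge (hier S k)) u v : joins e u v ->
  limit_mark (limit_vert u) (limit_vert v) = InfWord (limit_letters e).
Proof.
move=> j; rewrite /limit_mark; case: xgetP => [m _|/(_ (InfWord (limit_letters e)))[]].
  move=> [l [e' [u' [v' [uu vv j' ->]]]]].
  by rewrite (limit_letters_uniq j' j).
by exists k, e, u, v.
Qed.

Definition limit_mgraph (esc : escaping) : mgraph (oedge S) :=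
  @MGraph _ (limit_rgraph esc) limit_mark limit_mark_sym.

Definition level_mgraph k (e : oedge (hier S k.+1)) : mgraph (oedge S) :=
  marked_rooted (hier_simple S k.+1) (@hier_connected S k.+1)
    (fun f => FinWord (address f)) e.

Lemma limit_letters_restr k (e : oedge (hier S k.+1)) j : (j <= k.+1)%N ->
  mark_restr j (InfWord (limit_letters e)) = mark_restr j (FinWord (address e)).
Proof.
move=> jk /=; apply: (@eq_from_nth _ (seed_edge S)).
  by rewrite size_map size_rev size_iota size_drop size_tuple subKn.
move=> i; rewrite size_map size_rev size_iota => ij.
rewrite (nth_map 0%N) ?size_rev ?size_iota // nth_rev ?size_iota //.
rewrite nth_iota ?add0n; last by rewrite subnS; lia.
rewrite nth_drop /limit_letters ifT; last by lia.
rewrite nth_rev ?size_tuple; last by lia.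
by congr nth; lia.
Qed.

(** The ball of the limit is already complete at any level where it avoids the
    terminals. *)
Lemma limit_ball_miso (esc : escaping) k r j : (j <= k.+1)%N ->
  deep r (branch_edge k.+1) ->
  ball_miso r j (level_mgraph (branch_edge k.+1)) (limit_mgraph esc).
Proof.
move=> jk dk; set e := branch_edge k.+1 in dk *.
pose code (v : overt (hier S k.+1)) : nat := enum_rank v.
have code_inj : injective code by move=> u v /val_inj/enum_rank_inj.
(* from the numbering of the finite graph to the one of the union *)
pose f i := if [pick v | code v == i] is Some v then limit_vert v else 0%N.
have fE v : f (code v) = limit_vert v.
  rewrite /f; case: pickP => [v' /eqP/code_inj -> //|/(_ v)]; by rewrite eqxx.
have lv : limit_vert (osrc e) = (Defs.root (limit_mgraph esc)).1 /\
          limit_vert (otgt e) = (Defs.root (limit_mgraph esc)).2 by exact: limit_branch.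
have adjE u v : adj (level_mgraph e) (code u) (code v) = oadj u v.
  exact: rooted_adjE.
have code_vtx x : vtx (level_mgraph e) x -> exists v, x = code v.
  by move=> [v _ <-]; exists v.
have nearE x : near_root (level_mgraph e) r x <->
    exists v, x = code v /\ exists2 n, (n <= r)%N &
      walk (@oadj _) (osrc e) v n \/ walk (@oadj _) (otgt e) v n.
  split=> [nx|[v [-> [n nr wn]]]].
    have [v xv] := code_vtx _ (near_sub_vtx nx); exists v; split=> //; subst x.
    have pull a n : walk (adj (level_mgraph e)) (code a) (code v) n ->
        walk (@oadj (hier S k.+1)) a v n.
      move=> wn; have full u y' : predT u -> adj (level_mgraph e) (code u) y' ->
          exists2 v, y' = code v & oadj u v.
        move=> _ uy; have [y yy] : exists y, y' = code y.
          by apply: code_vtx; apply: (@adj_vtx _ _ (code u)); rewrite adj_sym.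
        by exists y => //; rewrite -adjE -yy.
      have [y /code_inj -> //] := walk_lift (r := n) full (fun _ _ _ _ => isT) (leqnn n) wn.
    have /near_rootP[n nr wn] := nx; exists n => //.
    by case: wn => wn; [left|right]; exact: pull wn.
  have push a : walk (@oadj (hier S k.+1)) a v n ->
      walk (adj (level_mgraph e)) (code a) (code v) n.
    by apply: walk_map => ? ?; rewrite adjE.
  by apply/near_rootP; exists n => //; case: wn => wn; [left|right]; exact: push wn.
have inner x v : x = code v -> near_root (level_mgraph e) r x -> inner_vert v.
  move=> -> /nearE[v' [/code_inj <- [n nr wn]]]; move/deepP: dk => dk.
  by case: wn; apply: dk => //; [left|right].
have near_inf y : near_root (limit_mgraph esc) r y <->
    exists v, y = limit_vert v /\ exists2 n, (n <= r)%N &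
      walk (@oadj (hier S k.+1)) (osrc e) v n \/ walk (@oadj (hier S k.+1)) (otgt e) v n.
  rewrite near_rootP -lv.1 -lv.2.
  move/deepP: dk => dk; split=> [[n nr]|[v [-> [n nr wn]]]].
    have full := @limit_adj_full k.+1.
    have pull a : a = osrc e \/ a = otgt e ->
        walk limit_adj (limit_vert a) y n ->
        exists2 v, y = limit_vert v & walk (@oadj (hier S k.+1)) a v n.
      move=> ae wn.
      exact: (walk_lift full (fun v m => dk a v m ae) nr wn).
    by case=> wn; [have [v -> wv] := pull _ (or_introl erefl) wn
      |have [v -> wv] := pull _ (or_intror erefl) wn];
      exists v; split=> //; exists n => //; [left|right].
  exists n => //.
  by case: wn => wn; [left|right]; apply: walk_map wn => ? ?; exact: limit_oadj.
exists f; split; first split.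
- split.
  + by move=> x /nearE[v [-> h]]; apply/near_inf; exists v; rewrite fE.
  + move=> x y; rewrite !in_setE => /nearE[u [-> _]] /nearE[v [-> _]].
    by rewrite !fE => /limit_vert_inj ->.
  + move=> y /near_inf[v [-> h]]; exists (code v); last exact: fE.
    by apply/nearE; exists v.
- move=> x y nx ny; have [u [xu _]] := (nearE x).1 nx; have [v [yv _]] := (nearE y).1 ny.
  rewrite xu yv !fE adjE; apply/idP/idP; last exact: limit_oadj.
  move=> /(limit_adj_full (inner _ _ xu nx))[v' /limit_vert_inj <- //].
- by left; rewrite !fE lv.1 lv.2; case: (Defs.root _).
- move=> x y nx ny; have [u [xu _]] := (nearE x).1 nx; have [v [yv _]] := (nearE y).1 ny.
  rewrite {}xu {}yv !fE adjE => /oadjP[g jg].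
  rewrite [edge_mark (limit_mgraph esc) _ _](limit_markE jg) limit_letters_restr //.
  congr mark_restr; rewrite /level_mgraph /=.
  case/orP: jg => /eqP[<- <-]; first by rewrite (rooted_markE (hier_simple S k.+1)).
  by rewrite rooted_mark_sym (rooted_markE (hier_simple S k.+1)).
Qed.

End limit.

(** * A uniform random word *)

Section random_word.
Variables (R : realType) (S : seed).
Local Notation N := #|oedge S|.

Lemma truncn_pmul_div (n : nat) (x : R) : (0 < n)%N -> 0 <= x ->
  (Num.truncn (n%:R * x) %/ n)%N = Num.truncn x.
Proof.
move=> n0 x0; set t := Num.truncn (n%:R * x).
have n0R : 0 < n%:R :> R by rewrite ltr0n.
have /andP[tl tu] : t%:R <= n%:R * x < t.+1%:R by apply: truncn_itv; exact: mulr_ge0.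
apply/esym/truncn_def; apply/andP; split.
  rewrite -(ler_pM2l n0R) -natrM; apply: le_trans tl; rewrite ler_nat mulnC.
  exact: leq_trunc_div.
rewrite -(ltr_pM2l n0R) -natrM; apply: lt_le_trans tu _; rewrite ler_nat mulnC.
exact: ltn_ceil.
Qed.

(** The word of the digits of [x] in base [#|oedge S|]. *)
Definition digit_word (x : R) (k : nat) : oedge S :=
  enum_val (Ordinal (ltn_pmod (Num.truncn (N%:R ^+ k.+1 * x)) (seed_edge_gt0 S))).

Lemma digit_wordE (x : R) k d : digit_word x k = d <->
  (Num.truncn (N%:R ^+ k.+1 * x) %% N)%N = enum_rank d.
Proof.
split=> [<-|h]; first by rewrite /digit_word enum_valK.
by apply: enum_rank_inj; apply: val_inj; rewrite /digit_word enum_valK.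
Qed.

(** The next digit cuts each interval of length [N ^- k] into [N] equal ones, one
    for every letter that can be prepended; so the edge selected by a uniform
    point is uniform at every level. *)
Lemma branch_cylinder k (e : oedge (hier S k)) : exists2 m, (m < N ^ k)%N &
  forall x, 0 <= x -> x < 1 ->
    (branch_edge (digit_word x) k = e <-> Num.truncn (N%:R ^+ k * x) = m).
Proof.
have N0 := seed_edge_gt0 S.
elim: k e => [[]|k IH e].
  exists 0%N => // x x0 x1; split=> // _; rewrite expr0 mul1r.
  by apply/eqP; rewrite -leqn0 truncn_le_nat.
have [d [e' ->]] := prefix_edge_surj e; have [m mN mE] := IH e'.
(* the letter prepended at level [k.+1] is the next digit, hence the finer one *)
exists (m * N + enum_rank d)%N.
  have dN : (enum_rank d < N)%N by exact: ltn_ord.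
  apply: (@leq_trans (m.+1 * N)%N); first by rewrite mulSn addnC ltn_add2r.
  by rewrite expnSr leq_mul2r mN orbT.
move=> x x0 x1; have := mE x x0 x1.
have Nx0 : 0 <= N%:R ^+ k * x by rewrite mulr_ge0 // exprn_ge0.
rewrite -(truncn_pmul_div N0 Nx0) mulrA -exprS => {}mE.
split=> [/prefix_edge_inj[/digit_wordE dE /mE <-]|xm].
  by rewrite -dE -divn_eq.
have wd : digit_word x k = d.
  by apply/digit_wordE; rewrite xm modnMDl modn_small //; exact: ltn_ord.
have be : branch_edge (digit_word x) k = e'.
  by apply/mE; rewrite xm divnMDl // divn_small ?addn0 //; exact: ltn_ord.
by rewrite /= wd be.
Qed.

Lemma measurable_truncn_eq (c : R) m :
  measurable [set x : R | Num.truncn (c * x) = m].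
Proof.
have mlt n : measurable [set x : R | (Num.truncn (c * x) < n)%N].
  case: n => [|n]; first by rewrite (_ : [set x | _] = set0) //; apply/seteqP; split.
  rewrite (_ : [set x | _] = (fun x => c * x) @^-1` `]-oo, n.+1%:R[%classic); last first.
    by apply/seteqP; split=> x /=; rewrite in_itv /= ltnS truncn_le_nat.
  rewrite -[X in measurable X]setTI; apply: (_ : measurable_fun setT _) => //.
  exact: mulrl_measurable.
rewrite (_ : [set x | _] = [set x | (Num.truncn (c * x) < m.+1)%N] `\`
    [set x | (Num.truncn (c * x) < m)%N]); first exact: measurableD.
apply/seteqP; split=> x /=; first by move=> ->; rewrite ltnSn ltnn.
by move=> [] /[!ltnS] xm /negP; rewrite -leqNgt => mx; apply/eqP; rewrite eqn_leq xm.
Qed.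

Lemma measurable_branch k (e : oedge (hier S k)) :
  measurable [set x : R | branch_edge (digit_word x) k = e].
Proof.
elim: k e => [[]|k IH e].
  by rewrite (_ : [set x | _] = setT) //; apply/seteqP; split=> // x _ /=; case: (branch_edge _ _).
have [d [e' ->]] := prefix_edge_surj e.
rewrite (_ : [set x | _] = [set x | branch_edge (digit_word x) k = e'] `&`
    \bigcup_(m in [set m | (m %% N)%N = enum_rank d])
      [set x | Num.truncn (N%:R ^+ k.+1 * x) = m]).
  apply: measurableI; first exact: IH.
  by apply: bigcup_measurable => m _; exact: measurable_truncn_eq.
apply/seteqP; split=> x /=.
  by move=> /prefix_edge_inj[/digit_wordE xd <-]; split=> //; eexists; first exact: xd.
by move=> [<- [m /= md xm]]; congr prefix_edge; apply/digit_wordE; rewrite xm.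
Qed.

Definition unit_law :=
  mrestr lebesgue_measure (measurable_itv `[(0 : R), 1[).

HB.instance Definition _ := Measure.on unit_law.

Lemma unit_law_setT : unit_law setT = 1%E.
Proof.
by rewrite /unit_law /mrestr setTI lebesgue_measure_itv /= lte_fin ltr01 oppr0 adde0.
Qed.

HB.instance Definition _ := Measure_isProbability.Build _ _ _ unit_law unit_law_setT.

Lemma branch_edge_law k (e : oedge (hier S k)) :
  unit_law [set x | branch_edge (digit_word x) k = e] = ((N ^ k)%:R^-1)%:E.
Proof.
have [m mN mE] := branch_cylinder e.
have Nk0 : 0 < (N ^ k)%:R :> R by rewrite ltr0n expn_gt0 seed_edge_gt0.
have itvE (x : R) : 0 <= x -> (Num.truncn (N%:R ^+ k * x) = m <->
    m%:R / (N ^ k)%:R <= x < m.+1%:R / (N ^ k)%:R).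
  move=> x0; rewrite ler_pdivrMr // ltr_pdivlMr // ![x * _]mulrC natrX -truncn_eq.
    by split=> [->|/eqP].
  by rewrite mulr_ge0 // exprn_ge0.
rewrite /unit_law /mrestr.
rewrite (_ : _ `&` _ = `[m%:R / (N ^ k)%:R, m.+1%:R / (N ^ k)%:R[%classic).
  rewrite lebesgue_measure_itv /= lte_fin ltr_pM2r ?invr_gt0 // ltr_nat ltnSn.
  by rewrite -EFinD -mulrBl -natrB // subSnn mul1r.
apply/seteqP; split=> x /=; rewrite !in_itv /=.
  by move=> [xe /andP[x0 x1]]; apply/itvE => //; apply/mE.
move=> xm; have /andP[xl xu] := xm.
have x0 : 0 <= x by apply: le_trans xl; rewrite divr_ge0.
have x1 : x < 1.
  by apply: lt_le_trans xu _; rewrite ler_pdivrMr // mul1r ler_nat.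
by rewrite x0 x1; split=> //; apply/mE => //; apply/itvE.
Qed.

Lemma card_hier_edge k : #|oedge (hier S k)| = (N ^ k)%N.
Proof.
by elim: k => [|k IH]; [rewrite card_unit|rewrite expnSr -IH -card_prod].
Qed.

Lemma measurable_branch_in k (B : pred (oedge (hier S k))) :
  measurable [set x : R | B (branch_edge (digit_word x) k)].
Proof.
rewrite (_ : [set x | _] =
    \bigcup_(e in [set e | B e]) [set x | branch_edge (digit_word x) k = e]).
  by apply: fin_bigcup_measurable => // e _; exact: measurable_branch.
apply/seteqP; split=> x /=; first by move=> Bx; eexists; first exact: Bx.
by move=> [e /= Be ->].
Qed.

Lemma branch_law k (B : pred (oedge (hier S k))) :
  unit_law [set x | B (branch_edge (digit_word x) k)] =
  (#|B|%:R / #|oedge (hier S k)|%:R)%:E.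
Proof.
rewrite card_hier_edge.
have main (s : seq (oedge (hier S k))) : uniq s ->
    unit_law [set x | branch_edge (digit_word x) k \in s] = ((size s)%:R / (N ^ k)%:R)%:E.
  elim: s => [|e s IH] /=.
    by move=> _; rewrite mul0r (_ : [set x | _] = set0) ?measure0 //; apply/seteqP; split.
  move=> /andP[es us].
  rewrite (_ : [set x | _] = [set x | branch_edge (digit_word x) k = e] `|`
      [set x | branch_edge (digit_word x) k \in s]); last first.
    apply/seteqP; split=> x /=; rewrite in_cons.
      by move=> /orP[/eqP|]; [left|right].
    by move=> [->|->]; rewrite ?eqxx ?orbT.
  transitivity (unit_law [set x | branch_edge (digit_word x) k = e] +
      unit_law [set x | branch_edge (digit_word x) k \in s])%E; last first.
    by rewrite branch_edge_law IH // -EFinD -[in RHS]natr1 mulrDl mul1r addrC.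
  apply: measureU.
  - exact: measurable_branch.
  - exact: (measurable_branch_in (mem s)).
  - by apply/seteqP; split=> // x [/= xe]; rewrite xe (negbTE es).
rewrite cardE -main ?enum_uniq //; congr unit_law.
by apply/seteqP; split=> x /=; rewrite mem_enum.
Qed.

(** For almost every word the root escapes from the terminals: at level [m + k],
    with [2 ^ m] larger than the radius, at most [2 N ^ m (N - 1) ^ k] of the
    [N ^ (m + k)] edges are close to a terminal. *)
Lemma ae_escaping : {ae unit_law, forall x, escaping (digit_word x)}.
Proof.
suff neg r : unit_law.-negligible
    [set x | forall k, ~~ deep r (branch_edge (digit_word x) k)].
  apply: negligibleS (negligible_bigcup neg) => x /= /existsNP[r nr].
  by exists r => // k /=; apply/negP => dk; apply: nr; exists k.
pose B k := [set x : R | ~~ deep r (branch_edge (digit_word x) k)].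
have mB k : measurable (B k).
  exact: (measurable_branch_in (fun e : oedge (hier S k) => ~~ deep r e)).
rewrite (_ : [set x | _] = \bigcap_k B k); last first.
  by apply/seteqP; split=> x xB k; [move=> _|]; exact: xB.
have mcap : measurable (\bigcap_k B k) by exact: bigcapT_measurable.
apply/negligibleP => //.
set q : R := N.-1%:R / N%:R.
have N0 : (0 < N)%N := seed_edge_gt0 S.
have q01 : `|q| < 1.
  rewrite ger0_norm; last by rewrite divr_ge0.
  by rewrite ltr_pdivrMr ?ltr0n // mul1r ltr_nat prednK.
have bound k : (unit_law (\bigcap_k B k) <= (2 * q ^+ k)%:E)%E.
  apply: (@le_trans _ _ (unit_law (B (r + k)%N))).
    apply: le_measure; [by rewrite inE|by rewrite inE; exact: mB|].
    by move=> x; apply.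
  rewrite [X in (X <= _)%E](branch_law (fun e : oedge (hier S (r + k)) => ~~ deep r e)).
  rewrite lee_fin card_hier_edge ler_pdivrMr ?ltr0n ?expn_gt0 ?N0 //.
  have -> : 2 * q ^+ k * (N ^ (r + k))%:R = (2 * (N ^ r * N.-1 ^ k))%:R.
    rewrite !natrM !natrX exprD expr_div_n.
    rewrite -(mulrA 2); congr (_ * _).
    by rewrite [N%:R ^+ r * _]mulrC mulrA divfK 1?mulrC // expf_neq0 // pnatr_eq0 -lt0n.
  rewrite ler_nat.
  (* [r] halvings bring the radius [r] down to zero *)
  have rr : (r < 2 ^ r)%N by exact: ltn_expl.
  have ca := card_near_vert_hier (fun l => erefl (inl (obeg (hier S l)))) k rr.
  have cb := card_near_vert_hier (fun l => erefl (inl (oend (hier S l)))) k rr.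
  apply: leq_trans (_ : (#|near_vert (obeg (hier S (r + k))) r| +
                        #|near_vert (oend (hier S (r + k))) r|) <= _)%N; last first.
    by rewrite mul2n -addnn leq_add.
  rewrite -cardUI; apply: leq_trans (leq_addr _ _); apply: subset_leq_card.
  apply/fintype.subsetP => e de.
  by move: (de : ~~ deep r e); rewrite /deep negb_and !negbK.
apply/eqP; rewrite eq_le measure_ge0 andbT.
have q0 : (2 * q ^+ k)%:E @[k --> \oo] --> (0 : \bar R)%E.
  apply: cvg_EFin; first exact: nearW.
  by rewrite -[0](mulr0 2); apply: cvgMr; exact: cvg_expr.
by apply: (cvge_to_ge q0); exact: nearW.
Qed.

End random_word.

(** * Distances and continuity *)

Section distances.
Variables (R : realType) (E : Type) (e0 : E).

Lemma mgraph_dist_le r j (G H : mgraph E) : ball_miso r j G H ->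
  mgraph_dist (mgraph_class R e0 G) (mgraph_class R e0 H) <= r.+1%:R^-1 + j.+1%:R^-1.
Proof.
move=> GH; rewrite mgraph_dist_class; apply: ge_inf; last by exists (r, j).
by exists 0 => _ [rj _ <-]; rewrite addr_ge0 // invr_ge0.
Qed.

Lemma forget_marks_dist (x y : mgraph_space R e0) :
  rgraph_dist (forget_marks x) (forget_marks y) <= mgraph_dist x y.
Proof.
rewrite /forget_marks rgraph_dist_class; apply: lb_le_inf.
  by eexists; exists (0%N, 0%N) => //; exact: ball_miso0.
move=> _ [[r j] /= [f [fiso _]] <-].
apply: le_trans (_ : r.+1%:R^-1 <= _); last by rewrite lerDl invr_ge0.
apply: ge_inf; first by exists 0 => _ [s _ <-]; rewrite invr_ge0.
by exists r => //; exists f.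
Qed.

Lemma forget_marks_continuous : continuous (@forget_marks R E e0).
Proof.
move=> x A /nbhs_ballP[e e_gt0 eA]; apply/nbhs_ballP; exists e => // y.
rewrite mgraph_ballE /= => xy; apply: eA; rewrite rgraph_ballE /=.
exact: le_lt_trans (forget_marks_dist _ _) xy.
Qed.

End distances.

Section borel.
Context (R : realType).

Lemma measurable_continuous_real (X : ptopologicalType) (f : X -> R) :
  continuous f -> measurable_fun [set: borel X] f.
Proof.
move=> /continuousP cf; apply: (measurability _ (RGenOpens.measurableE R)).
move=> _ [_ [a [b ->] <-]]; rewrite setTI; apply: sub_sigma_algebra.
exact/cf/interval_open.
Qed.

Lemma measurable_continuous_borel (X Y : ptopologicalType) (f : X -> Y) :
  continuous f -> measurable_fun [set: borel X] (f : borel X -> borel Y).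
Proof.
move=> /continuousP cf; apply: (@measurability _ _ (borel X) (borel Y) setT f (@open Y) erefl).
move=> _ [A oA <-]; rewrite setTI; apply: sub_sigma_algebra; exact: cf.
Qed.

Lemma bounded_integrable d (T : measurableType d) (P : probability T R) (f : T -> R) (M : R) :
  measurable_fun setT f -> (forall x, `|f x| <= M) ->
  P.-integrable setT (EFin \o f).
Proof.
move=> mf fM; apply: (@le_integrable _ _ _ _ _ _ _ (EFin \o cst M)) => //.
- exact/measurable_EFinP.
- by move=> x _ /=; rewrite lee_fin; apply: le_trans (fM _) (ler_norm M).
- exact: finite_measure_integrable_cst.
Qed.

End borel.

(** * The limit law *)

Section limit_law.
Variables (R : realType) (S : seed).
Local Notation space := (mgraph_space R (seed_edge S)).

Definition level_graph (k : nat) (x : measurableTypeR R) : borel space :=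
  mgraph_class R (seed_edge S) (level_mgraph (branch_edge (digit_word S x) k.+1)).

(** The value at the words that are not escaping is arbitrary: they form a null
    set. *)
Definition limit_graph (x : measurableTypeR R) : borel space :=
  match pselect (escaping (digit_word S x)) with
  | left esc => mgraph_class R (seed_edge S) (limit_mgraph esc)
  | right _ => point
  end.

Lemma level_limit_dist (x : R) k r : escaping (digit_word S x) ->
  (r <= k)%N -> deep r (branch_edge (digit_word S x) k.+1 : oedge (hier S k.+1)) ->
  mgraph_dist (level_graph k x : space) (limit_graph x : space) <=
    r.+1%:R^-1 + r.+1%:R^-1.
Proof.
rewrite /limit_graph => esc rk dr; case: pselect => // esc'.
by apply: mgraph_dist_le; apply: limit_ball_miso => //; exact: leqW.
Qed.

Lemma invS_half (e : R) : 0 < e -> exists r : nat, r.+1%:R^-1 + r.+1%:R^-1 < e.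
Proof.
move=> e0; have /invS_small[r re] : 0 < e / 2 by rewrite divr_gt0.
by exists r; rewrite [e]splitr ltrD.
Qed.

Lemma level_graph_cvg (x : R) : escaping (digit_word S x) ->
  (level_graph k x : space) @[k --> \oo] --> (limit_graph x : space).
Proof.
move=> esc; apply/cvg_ballP => e /invS_half[r re].
have [k0 dk0] := esc r.
exists (maxn k0 r) => // k /=; rewrite geq_max => /andP[k0k rk].
apply: ball_sym; rewrite mgraph_ballE /=; apply: le_lt_trans re.
apply: level_limit_dist => //.
by apply: deep_branch_mono dk0; exact: leqW.
Qed.

Lemma level_graph_preimage k (A : set (borel space)) : level_graph k @^-1` A =
  [set x | [pred e | mgraph_class R (seed_edge S) (level_mgraph e) \in A]
             (branch_edge (digit_word S x) k.+1)].
Proof. by apply/seteqP; split=> x /=; rewrite inE. Qed.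

Lemma measurable_level_graph k : measurable_fun setT (level_graph k).
Proof.
move=> _ A _; rewrite setTI level_graph_preimage; exact: measurable_branch_in.
Qed.

Lemma measurable_escaping : measurable [set x : R | escaping (digit_word S x)].
Proof.
rewrite (_ : [set x | _] = \bigcap_r \bigcup_k
    [set x : R | deep r (branch_edge (digit_word S x) k : oedge (hier S k))]).
  apply: bigcapT_measurable => r; apply: bigcupT_measurable => k.
  exact: measurable_branch_in.
apply/seteqP; split=> x esc r; first by move=> _; have [k] := esc r; exists k.
by have [k _ dk] := esc r I; exists k.
Qed.

(** An open set that contains the limit graph of [x] contains the limit graphs of
    all escaping words with the same first letters, up to some length. So the
    preimage of an open set is, within the escaping words, a countable union of
    cylinders. *)
Lemma measurable_limit_graph : measurable_fun setT limit_graph.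
Proof.
apply: (@measurability _ _ _ (borel space) setT limit_graph (@open space) erefl).
move=> _ [U oU <-]; rewrite setTI.
pose esc (x : R) := escaping (digit_word S x).
pose good k (e : oedge (hier S k)) := `[< forall x : R, esc x ->
  branch_edge (digit_word S x) k = e -> U (limit_graph x) >].
rewrite (_ : _ @^-1` _ =
    ([set x | esc x] `&` \bigcup_k [set x : R | good k (branch_edge (digit_word S x) k)])
    `|` (~` [set x | esc x] `&` [set x | U point])).
  apply: measurableU; apply: measurableI.
  - exact: measurable_escaping.
  - by apply: bigcupT_measurable => k; exact: (measurable_branch_in (@good k)).
  - by apply: measurableC; exact: measurable_escaping.
  - case: (pselect (U point)) => h.
      by rewrite (_ : [set x | _] = setT) //; apply/seteqP; split.
    by rewrite (_ : [set x | _] = set0) //; apply/seteqP; split.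
apply/seteqP; split=> x /=; last first.
  move=> [[ex [k _ /= /asboolP gk]]|[nx Up]]; first exact: gk.
  by rewrite /limit_graph; case: pselect.
move=> Ux; case: (pselect (esc x)) => ex; last first.
  by right; split=> //; move: Ux; rewrite /limit_graph; case: pselect.
left; split=> //.
have /nbhs_ballP[e /= e0 eU] : nbhs (limit_graph x : space) U.
  exact: open_nbhs_nbhs.
have /invS_half[r re] : 0 < e / 2 by rewrite divr_gt0.
have [k0 dk0] := ex r; pose k := maxn k0 r.
have dk : deep r (branch_edge (digit_word S x) k.+1 : oedge (hier S k.+1)).
  by apply: deep_branch_mono dk0; rewrite leqW // leq_maxl.
exists k.+1 => //=; apply/asboolP => y ey yx; apply: eU.
have lx : level_graph k x = level_graph k y by rewrite /level_graph yx.
apply: (@ball_splitr _ _ (level_graph k x : space)); rewrite mgraph_ballE /=.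
  by apply: le_lt_trans re; apply: level_limit_dist => //; exact: leq_maxr.
rewrite lx; apply: le_lt_trans re; apply: level_limit_dist => //; first exact: leq_maxr.
by rewrite yx.
Qed.

HB.instance Definition _ k :=
  isMeasurableFun.Build _ _ _ _ (level_graph k) (@measurable_level_graph k).
HB.instance Definition _ :=
  isMeasurableFun.Build _ _ _ _ limit_graph measurable_limit_graph.

Definition limit_law : probability (borel space) R :=
  distribution (@unit_law R) limit_graph.

Lemma marked_hier_lawE k A :
  marked_hier_law R S k A = distribution (@unit_law R) (level_graph k) A.
Proof.
rewrite /distribution /pushforward level_graph_preimage.
by rewrite [RHS](branch_law R [pred e | mgraph_class R (seed_edge S) (level_mgraph e) \in A]).
Qed.

(** The laws of all levels are carried by the same uniform point, and the graphs
    it selects converge almost surely. *)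
Lemma marked_hier_law_cvg : cvg_in_distribution (marked_hier_law R S) limit_law.
Proof.
move=> g cg [M gM].
have mg := measurable_continuous_real cg.
have mgX (X : {mfun measurableTypeR R >-> borel space}) :
    measurable_fun setT (g \o X).
  exact: measurableT_comp mg (@measurable_funPT _ _ _ _ X).
have push (X : {mfun measurableTypeR R >-> borel space}) :
    (\int[distribution (@unit_law R) X]_y (g y)%:E = \int[@unit_law R]_x (g (X x))%:E)%E.
  apply: integral_distribution; first exact/measurable_EFinP.
  exact: bounded_integrable (mgX X) (fun x => gM (X x)).
have -> : (fun k => \int[marked_hier_law R S k]_x (g x)%:E)%E =
    (fun k => \int[@unit_law R]_x (EFin (g (level_graph k x))))%E.
  apply/funext => k; rewrite -push.
  by apply: eq_measure_integral => A _ _; exact: marked_hier_lawE.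
rewrite /limit_law push.
have ae_cvg : {ae @unit_law R, forall x, setT x ->
    (g (level_graph k x))%:E @[k --> \oo] --> (g (limit_graph x))%:E}.
  have [B [mB B0 sB]] := @ae_escaping R S; exists B; split=> //.
  apply: subset_trans sB => x /= nx esc; apply: nx => _.
  apply: cvg_EFin; first exact: nearW.
  exact: (cvg_comp _ _ (level_graph_cvg esc) (cg _)).
have dom : {ae @unit_law R, forall x k, setT x ->
    (`|(g (level_graph k x))%:E| <= (EFin \o cst M) x)%E}.
  by apply: aeW => x k _; rewrite /= lee_fin.
have Mint : (@unit_law R).-integrable setT (EFin \o cst M).
  exact: finite_measure_integrable_cst.
by have [] := dominated_convergence measurableT
  (fun k => (measurable_EFinP _ _).2 (mgX (level_graph k)))
  ((measurable_EFinP _ _).2 (mgX limit_graph)) ae_cvg Mint dom.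
Qed.

Definition forget_mfun : borel space -> borel (rgraph_space R) :=
  @forget_marks R _ (seed_edge S).

Let measurable_forget : measurable_fun setT forget_mfun.
Proof. by apply: measurable_continuous_borel; exact: forget_marks_continuous. Qed.

HB.instance Definition _ :=
  isMeasurableFun.Build _ _ _ _ forget_mfun measurable_forget.

Lemma hier_law_forget k A :
  hier_law R S k.+1 A = distribution (marked_hier_law R S k) forget_mfun A.
Proof.
congr (_%:R / _)%:E; apply: eq_card => e.
rewrite !inE /preimage /= /forget_mfun; congr (asbool (A _)).
by rewrite forget_marks_class.
Qed.

(** Level [0], whose only edge has an empty address, is not the image of a marked
    law; dropping it does not change the limit. *)
Lemma hier_law_cvg : cvg_in_distribution (hier_law R S) (distribution limit_law forget_mfun).
Proof.
move=> g cg [M gM].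
have mg := measurable_continuous_real cg.
have mgf := measurableT_comp mg (@measurable_funPT _ _ _ _ forget_mfun).
have push (P : probability (borel space) R) :
    (\int[distribution P forget_mfun]_y (g y)%:E = \int[P]_x (g (forget_mfun x))%:E)%E.
  apply: integral_distribution; first exact/measurable_EFinP.
  exact: bounded_integrable mgf (fun x => gM (forget_mfun x)).
rewrite push -(cvg_shiftS (fun k => (\int[hier_law R S k]_x (g x)%:E)%E)) /=.
have -> : (fun k => (\int[hier_law R S k.+1]_x (g x)%:E)%E) =
    (fun k => (\int[marked_hier_law R S k]_x (g (forget_mfun x))%:E)%E).
  apply/funext => k; rewrite -push.
  by apply: eq_measure_integral => A _ _; exact: hier_law_forget.
apply: (marked_hier_law_cvg (f := g \o forget_mfun)).
  by move=> x; apply: continuous_comp; [exact: forget_marks_continuous|exact: cg].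
by exists M => x; exact: gM.
Qed.

End limit_law.

Theorem proposition5p7 (R : realType) (G1 : ograph)
    (G1_simple : osimple G1) (G1_connected : oconnected G1)
    (G1_dist : (1 < gdist (@oadj G1) (obeg G1) (oend G1))%N)
    (G1_paths : two_edge_disjoint_paths (obeg G1) (oend G1)) :
  let S := Seed G1_simple G1_connected G1_dist in
  exists (mu : probability (borel (rgraph_space R)) R)
         (nu : probability (borel (mgraph_space R (seed_edge S))) R),
    [/\ cvg_in_distribution (hier_law R S) mu,
        cvg_in_distribution (marked_hier_law R S) nu &
        forall A : set (borel (rgraph_space R)), measurable A ->
          nu [set x | A (forget_marks x)] = mu A].
Proof.
move=> S.
exists (distribution (limit_law R S) (@forget_mfun R S)), (limit_law R S); split=> //.
  exact: hier_law_cvg.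
exact: marked_hier_law_cvg.
Qed.
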